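(* Let $1/2<\alpha\le1$ and let $X_1,\dots,X_n$ be i.i.d. with probability density $f_0$ on $[0,1]$ such that $0<\rho_0\le f_0\le D_0<\infty$ for some constants $\rho_0,D_0$, and $f_0\in\mathcal C^\alpha[0,1]$. Let $h_n=(n/\log n)^{-1/(2\alpha+1)}$, $L=L_n=\lfloor\log_2(1/h_n)\rfloor$, and let the prior $\Pi$ be the law of the random histogram $$f(x)=2^{L}\sum_{k=0}^{2^{L}-1}\omega_k\mathbf 1_{I_k^{L}}(x),$$ where $I_0^L=[0,2^{-L}]$, $I_k^L=(k2^{-L},(k+1)2^{-L}]$ for $1\le k\le2^L-1$, and $(\omega_0,\dots,\omega_{2^L-1})$ has the Dirichlet distribution $\mathcal D(\alpha_0,\dots,\alpha_{2^L-1})$ on the unit simplex, with parameters $\alpha_k=\alpha_{k,L_n}$ (allowed to depend on $n$) satisfying $c_12^{-La}\le\alpha_k\le c_2$ for all $k$ and $n$, for some fixed constants $a,c_1,c_2>0$. Then for every sequence $M_n\to\infty$, $$E_{f_0}^n\,\Pi\Big[f:\|f-f_0\|_\infty>M_n\Big(\frac{\log n}{n}\Big)^{\alpha/(2\alpha+1)}\,\Big|\,X^{(n)}\Big]\to0\quad(n\to\infty).$$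
   Context: $\mathcal C^\alpha[0,1]$ for $0<\alpha\le1$ is the space of functions $g$ with $|g(x)-g(y)|\le C|x-y|^\alpha$ for some $C$ (for $\alpha=1$: Lipschitz). The posterior is $\Pi(B\mid X^{(n)})=\int_B\prod_i f(X_i)\,d\Pi(f)/\int\prod_if(X_i)\,d\Pi(f)$, and $E^n_{f_0}$ is expectation under $X_1,\dots,X_n$ i.i.d. $f_0$. *)

(* Defs.v *)
From HB Require Import structures.
From mathcomp Require Import all_boot all_order all_algebra.
From mathcomp Require Import all_classical all_reals all_analysis.
Set Implicit Arguments. Unset Strict Implicit. Unset Printing Implicit Defensive.
Import Order.TTheory GRing.Theory Num.Theory.
Local Open Scope classical_set_scope.
Local Open Scope ring_scope.

Section Defs.
Variable R : realType.
Local Notation mu := (@lebesgue_measure R).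
Definition I01 : set R := `[0%R, 1%R]%classic.

Definition holder (alpha : R) (g : R -> R) : Prop :=
  exists C : R, forall x y : R, x \in I01 -> y \in I01 ->
    `|g x - g y| <= C * `|x - y| `^ alpha.

Definition density01 (f : R -> R) : Prop :=
  measurable_fun I01 f /\ (forall x, x \in I01 -> 0 <= f x) /\
  (\int[mu]_(x in I01) (f x)%:E = 1)%E.

Definition supnorm01 (g : R -> R) : \bar R :=
  ereal_sup [set (`|g x|)%:E | x in I01].

Definition vcons (x : R) (v : nat -> R) : nat -> R :=
  fun i => if i is j.+1 then v j else x.

(* iterated (Tonelli) integral of F over [0,1]^m w.r.t. Lebesgue measure;
   coordinates 0..m-1 of the argument are the integration variables *)
Fixpoint iint (m : nat) (F : (nat -> R) -> \bar R) : \bar R :=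
  match m with
  | 0 => F (fun _ => 0)
  | m'.+1 => (\int[mu]_(x in I01) iint m' (fun v => F (vcons x v)))%E
  end.

Definition hn (alpha : R) (n : nat) : R :=
  (n%:R / ln n%:R) `^ (- (1 / (2 * alpha + 1))).
Definition Ln (alpha : R) (n : nat) : nat :=
  Num.truncn (ln (hn alpha n)^-1 / ln 2).
Definition epsn (alpha : R) (n : nat) : R :=
  (ln n%:R / n%:R) `^ (alpha / (2 * alpha + 1)).

Definition inbin (L k : nat) (x : R) : bool :=
  if k == 0%N then (0 <= x) && (x <= (2 ^+ L)^-1)
  else (k%:R * (2 ^+ L)^-1 < x) && (x <= k.+1%:R * (2 ^+ L)^-1).

Definition hist (L : nat) (w : nat -> R) (x : R) : R :=
  2 ^+ L * \sum_(k < 2 ^ L) w k * (inbin L k x)%:R.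

(* Dirichlet D(a_0,..,a_{K-1}) on the unit simplex of R^K: the free
   coordinates are w_0..w_{K-2}, and w_{K-1} = 1 - sum of the others. *)
Definition simplex_complete (K : nat) (v : nat -> R) : nat -> R :=
  fun k => if (k < K.-1)%N then v k else 1 - \sum_(j < K.-1) v j.
Definition simplex_interior (K : nat) (v : nat -> R) : bool :=
  [forall j : 'I_K, 0 < simplex_complete K v j].
Definition dir_int (K : nat) (a : nat -> R) (g : (nat -> R) -> R) : \bar R :=
  iint K.-1 (fun v =>
    if simplex_interior K v then
      (g (simplex_complete K v) *
       \prod_(k < K) (simplex_complete K v k) `^ (a k - 1))%:E
    else 0%E).
Definition dir_expect (K : nat) (a : nat -> R) (g : (nat -> R) -> R) : R :=
  fine (dir_int K a g) / fine (dir_int K a (fun _ => 1)).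

Definition hist_posterior (L : nat) (a : nat -> R) (n : nat) (X : nat -> R)
    (B : set (R -> R)) : R :=
  dir_expect (2 ^ L) a (fun w => (hist L w \in B)%:R *
                                  \prod_(i < n) hist L w (X i)) /
  dir_expect (2 ^ L) a (fun w => \prod_(i < n) hist L w (X i)).

Definition expect_iid (f0 : R -> R) (n : nat) (G : (nat -> R) -> R) : \bar R :=
  iint n (fun X => ((\prod_(i < n) f0 (X i)) * G X)%:E).

End Defs.
Arguments I01 {R}.

(* Main.v *)
Require Import Defs.
From HB Require Import structures.
From mathcomp Require Import all_boot all_order all_algebra.
From mathcomp Require Import all_classical all_reals all_analysis.
From mathcomp Require Import measurable_realfun ring lra.
Import Order.TTheory GRing.Theory Num.Theory.
Import numFieldNormedType.Exports.
Set Implicit Arguments. Unset Strict Implicit. Unset Printing Implicit Defensive.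
Local Open Scope classical_set_scope.
Local Open Scope ring_scope.

(** By conjugacy the posterior of [w] is Dirichlet with parameters
    [A k = a k + N_k], [N_k] being the number of observations in bin [k].  With
    [K = 2 ^ L] bins and [p_k] the mass that [f0] gives to bin [k], the choice of
    [L] gives [eps ^ 2 * n / K >= ln n], so that Chernoff's bound with tilt [eps]
    makes [|N_k - n p_k| > (2 D0 + 2) eps n / K] an event of probability at most
    [2 / n ^ 2].  When it fails for all [k], every [A k] is larger than 1, and
    Markov's inequality applied to the posterior moments [w_k ^ m] and
    [w_k ^ - m], with [m] the integer part of [eps n / K], bounds the posterior
    probability of [|w_k - p_k| > (7 D0 + 5) eps / K] by [2 / n ^ 2].  These
    moments are ratios of Dirichlet normalizing constants, computed by
    integrating out the innermost coordinate.  A union bound over the [K <= n]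
    bins leaves [4 / n], while the bias [|f0 - K p_k|] is of order
    [K ^ - alpha <= 2 eps]. *)

(** * Iterated integrals over the unit cube *)

Section iterated_integrals.
Context {R : realType}.
Local Notation mu := (@lebesgue_measure R).
Implicit Types (F G : (nat -> R) -> \bar R).

(* [integral] is a lower integral on nonnegative functions, hence monotone even
   without measurability; this disposes of the indicator of the sup-norm event. *)
Lemma ge0_le_lower_integral (D : set R) (f g : R -> \bar R) :
  (forall x, D x -> 0 <= f x)%E -> (forall x, D x -> f x <= g x)%E ->
  (\int[mu]_(x in D) f x <= \int[mu]_(x in D) g x)%E.
Proof.
move=> f0 fg.
have g0 x : D x -> (0 <= g x)%E.
  by move=> Dx; exact: le_trans (f0 _ Dx) (fg _ Dx).
rewrite !ge0_integralE//; apply: ereal_sup_le => _ [h /= hf <-].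
exists h => //= x; apply: le_trans (hf x) _.
by apply: lee_restrict => y Dy; exact: fg.
Qed.

Lemma measurable_I01 : measurable (@I01 R).
Proof. exact: measurable_itv. Qed.

(** Nonnegativity is proved jointly with monotonicity because the induction needs it to compare the
    inner integrals as lower integrals. *)
Lemma le_iint m F G :
  (forall v, (forall i, (i < m)%N -> v i \in I01) -> 0 <= F v)%E ->
  (forall v, (forall i, (i < m)%N -> v i \in I01) -> F v <= G v)%E ->
  (0 <= iint m F)%E /\ (iint m F <= iint m G)%E.
Proof.
elim: m F G => [|m IH] F G F0 FG /=; first by split; [apply: F0|apply: FG].
have vI x v : I01 x -> (forall i, (i < m)%N -> v i \in I01) ->
    forall i, (i < m.+1)%N -> vcons x v i \in I01.
  by move=> Dx vD [|i]//= im; [rewrite inE | exact: vD].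
have H x : I01 x -> (0 <= iint m (fun v => F (vcons x v)))%E /\
   (iint m (fun v => F (vcons x v)) <= iint m (fun v => G (vcons x v)))%E.
  by move=> Dx; apply: IH => v vD; [apply: F0|apply: FG]; exact: vI.
split; first by apply: integral_ge0 => x /H[].
by apply: ge0_le_lower_integral => x /H[].
Qed.

Lemma eq_iint m F G :
  (forall v, (forall i, (i < m)%N -> v i \in I01) -> F v = G v) ->
  iint m F = iint m G.
Proof.
elim: m F G => [|m IH] F G FG /=; first exact: FG.
apply: eq_integral => x xI; apply: IH => v vD; apply: FG.
by case=> [|i]//= im; exact: vD.
Qed.

Definition vset (v : nat -> R) (m : nat) (y : R) : nat -> R :=
  fun i => if i == m then y else v i.

(** The order of integration is unchanged, so no exchange of integrals is involved. The innermost
    coordinate is exposed because the Dirichlet recursion eliminates it first. *)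
Lemma iint_last m F :
  iint m.+1 F = iint m (fun v => \int[mu]_(y in I01) F (vset v m y))%E.
Proof.
elim: m F => [|m IH] F /=.
  apply: eq_integral => x _; congr F.
  by apply/funext => -[|i].
apply: eq_integral => x _.
rewrite -[LHS]/(iint m.+1 (fun v => F (vcons x v))) IH.
apply: eq_iint => v _; apply: eq_integral => y _; congr F.
by apply/funext => -[|i].
Qed.

(* The domain of [mu] and [R] carry convertible sigma-algebras under different
   displays, which unification does not see through. *)
Lemma measurable_EFin (f : R -> R) (D : set R) : measurable_fun D f ->
  @measurable_fun _ _ (measurableTypeR R) (\bar R) D (fun x => (f x)%:E).
Proof. by move=> mf; have /measurable_EFinP := mf. Qed.

Lemma integral_lincomb (D : set R) (mD : measurable D) (I : finType) (c : I -> R)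
    (phi : I -> R -> R) (t : I -> R) :
  (forall j, 0 <= c j) -> (forall j, measurable_fun D (phi j)) ->
  (forall j x, D x -> 0 <= phi j x) ->
  (forall j, \int[mu]_(x in D) (phi j x)%:E = (t j)%:E)%E ->
  (\int[mu]_(x in D) (\sum_j c j * phi j x)%:E = (\sum_j c j * t j)%:E)%E.
Proof.
move=> c0 mphi phi0 tE.
under eq_integral do rewrite -sumEFin.
rewrite ge0_integral_sum//=.
- rewrite -sumEFin; apply: eq_bigr => j _.
  under eq_integral do rewrite EFinM.
  rewrite ge0_integralZl_EFin//; first by rewrite tE.
  by move=> x Dx; rewrite lee_fin phi0.
  exact: measurable_EFin (mphi j).
- move=> j; apply: (@measurable_EFin (fun x => c j * phi j x)).
  by apply: measurable_funM => //; exact: measurable_cst.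
- by move=> j x Dx; rewrite lee_fin mulr_ge0 ?phi0.
Qed.

(** A finite sum of products keeps its shape under each integration: the factors at a coordinate
    held fixed pass into the coefficients, so the induction is general in [c]. The Chernoff majorant
    of the posterior has this form. *)
Lemma iint_sum_prod n (I : finType) (c : I -> R) (phi : I -> R -> R) (t : I -> R) :
  (forall j, 0 <= c j) -> (forall j, measurable_fun I01 (phi j)) ->
  (forall j x, I01 x -> 0 <= phi j x) ->
  (forall j, \int[mu]_(x in I01) (phi j x)%:E = (t j)%:E)%E ->
  iint n (fun X => (\sum_j c j * \prod_(i < n) phi j (X i))%:E) =
  (\sum_j c j * t j ^+ n)%:E.
Proof.
move=> + mphi phi0 tE; elim: n c => [|n IH] c c0 /=.
  by congr EFin; apply: eq_bigr => j _; rewrite big_ord0 expr0.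
have t0 j : 0 <= t j.
  by rewrite -lee_fin -tE; apply: integral_ge0 => x /(phi0 j); rewrite lee_fin.
transitivity (\int[mu]_(x in I01) (\sum_j (c j * t j ^+ n) * phi j x)%:E)%E.
  apply: eq_integral => x; rewrite inE => Dx.
  transitivity (iint n (fun X => (\sum_j (c j * phi j x) *
      \prod_(i < n) phi j (X i))%:E)).
    apply: eq_iint => v _; congr EFin; apply: eq_bigr => j _.
    by rewrite big_ord_recl /= mulrA.
  rewrite IH; last by move=> j; rewrite mulr_ge0 ?phi0.
  by congr EFin; apply: eq_bigr => j _; rewrite mulrAC.
rewrite (integral_lincomb measurable_I01 (t := t))//; last first.
  by move=> j; rewrite mulr_ge0 ?exprn_ge0.
by congr EFin; apply: eq_bigr => j _; rewrite exprSr mulrA.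
Qed.

End iterated_integrals.

(** * The Beta function and its recursions *)

Section beta_integrals.
Context {R : realType}.
Local Notation mu := (@lebesgue_measure R).
Implicit Types a b c r y : R.

(* [powR] is constantly 1 on negative numbers, so it has to be truncated there
   to be continuous at 0. *)
Definition pospow (c : R) (y : R) : R := (Num.max y 0) `^ c.

Lemma pospowE c y : 0 <= y -> pospow c y = y `^ c.
Proof. by move=> y0; rewrite /pospow max_l. Qed.

Lemma pospow_eq0 c y : 0 < c -> y <= 0 -> pospow c y = 0.
Proof. by move=> c0 y0; rewrite /pospow max_r// powR0// gt_eqF. Qed.

Lemma pospow_ge0 c y : 0 <= pospow c y.
Proof. exact: powR_ge0. Qed.

Lemma is_derive_pospow c y : 0 < y ->
  is_derive y 1 (pospow c) (c * pospow (c - 1) y).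
Proof.
move=> y0; rewrite pospowE ?ltW//.
apply: (near_eq_is_derive _ (is_derive1_powR c y0)).
near=> z; rewrite pospowE//.
by apply: ltW; near: z; exact: lt_nbhsr.
Unshelve. all: by end_near. Qed.

Lemma continuous_pospow c : 0 < c -> continuous (pospow c).
Proof.
move=> c0 x; have [x0|x0|x0] := ltgtP x 0.
- have : (cst 0 : R -> R) @ x --> (0 : R) by exact: cvg_cst.
  rewrite /continuous_at pospow_eq0 ?ltW//.
  apply: cvg_trans; apply: near_eq_cvg.
  near=> y; rewrite pospow_eq0//.
  by apply: ltW; near: y; exact: lt_nbhsl.
- have [D _] := is_derive_pospow c x0.
  exact: differentiable_continuous ((derivable1_diffP _ _).1 D).
- rewrite x0 /continuous_at (pospow_eq0 c0)//.
  apply/cvgrPdist_lt => e e0; near=> y.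
  rewrite sub0r normrN.
  have [y0|y0] := leP y 0; first by rewrite pospow_eq0// normr0.
  rewrite pospowE ?ltW// ger0_norm ?powR_ge0//.
  (* Writing [e] as a power with exponent [c] yields the radius of the neighbourhood of 0. *)
  have -> : e = (e `^ c^-1) `^ c by rewrite -powRrM mulVf ?gt_eqF// powRr1// ltW.
  rewrite gt0_ltr_powR ?nnegrE ?powR_ge0 ?ltW//.
  rewrite (le_lt_trans (ler_norm _))//.
  near: y; exists (e `^ c^-1); first exact: powR_gt0.
  by move=> z /=; rewrite sub0r normrN.
Unshelve. all: by end_near. Qed.

Lemma continuous_pospowB c r : 0 < c -> continuous (fun y => pospow c (r - y)).
Proof.
move=> c0 y; apply: (@continuous_comp _ _ _ (fun y => r - y) (pospow c)).
  by apply: continuousB; [exact: cvg_cst|exact: cvg_id].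
exact: continuous_pospow.
Qed.

(** For [a] and [b] above 1 this is the Beta kernel on [[0, r]], extended continuously by 0, so that
    it can be integrated over the fixed interval [I01]. *)
Definition betak (a b r y : R) : R := pospow (a - 1) y * pospow (b - 1) (r - y).

Lemma betak_ge0 a b r y : 0 <= betak a b r y.
Proof. by rewrite mulr_ge0 ?pospow_ge0. Qed.

Lemma continuous_betak a b r : 1 < a -> 1 < b -> continuous (betak a b r).
Proof.
move=> a1 b1 y; apply: continuousM; first by apply: continuous_pospow; rewrite subr_gt0.
by apply: continuous_pospowB; rewrite subr_gt0.
Qed.

Lemma integrable_betak a b r : 1 < a -> 1 < b ->
  mu.-integrable I01 (EFin \o betak a b r).
Proof.
move=> a1 b1; apply: continuous_compact_integrable; first exact: segment_compact.
by apply: continuous_subspaceT; exact: continuous_betak.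
Qed.

(** Euler's Beta function, for parameters above 1. *)
Definition betaJ (a b : R) : R := (\int[mu]_(y in I01) betak a b 1 y)%R.

Lemma betaJ_ge0 a b : 0 <= betaJ a b.
Proof. by apply: Rintegral_ge0 => y _; exact: betak_ge0. Qed.

Lemma integral_betak1 a b : 1 < a -> 1 < b ->
  (\int[mu]_(y in I01) (betak a b 1 y)%:E = (betaJ a b)%:E)%E.
Proof.
move=> a1 b1; rewrite /betaJ /Rintegral fineK//.
by apply: integrable_fin_num; [exact: measurable_I01|exact: integrable_betak].
Qed.

(** The substitution [y = r * u] scales the kernel by [r ^ (a + b - 2)] and lengths by [r]. The
    bound [r <= 1] keeps [[0, r]] inside [I01]. *)
Lemma integral_betak a b r : 1 < a -> 1 < b -> r <= 1 ->
  (\int[mu]_(y in I01) (betak a b r y)%:E = (pospow (a + b - 1) r * betaJ a b)%:E)%E.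
Proof.
(* For [r <= 0] the second factor of the kernel vanishes on all of [I01], and the right-hand side is
   0 as well. *)
move=> a1 b1 r1; have [r0|r0] := leP r 0.
  rewrite pospow_eq0//; last by lra.
  rewrite mul0r; apply: integral0_eq => y; rewrite /I01/= in_itv/= => /andP[y0 _].
  by rewrite /betak [X in _ * X]pospow_eq0 ?mulr0//; lra.
(* The kernel is 0 beyond [r]; the endpoints are written as images of 0 and 1 so that the change of
   variables applies. *)
have -> : (\int[mu]_(y in I01) (betak a b r y)%:E =
           \int[mu]_(y in `[(r * 0)%R, (r * 1)%R]) (betak a b r y)%:E)%E.
  rewrite !mulr0 !mulr1 integral_mkcond [RHS]integral_mkcond; congr integral.
  apply/funext => y; rewrite /patch/= /I01 !mem_setE !in_itv/=.
  have [y0|//] := leP 0 y; have [yr|yr]/= := leP y r.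
    by rewrite (le_trans yr r1).
  by case: ifP => // _; rewrite /betak [X in _ * X]pospow_eq0 ?mulr0//; lra.
have F' : derive1 (fun u : R => r * u) = cst r.
  by apply/funext => u; rewrite derive1E derive_val ?scaler1//; exact: mulr1.
rewrite (@integration_by_substitution_increasing _ (fun u => r * u))//.
- rewrite F' pospowE ?ltW// EFinM -(integral_betak1 a1 b1).
  rewrite -ge0_integralZl_EFin ?powR_ge0//; last 3 first.
  + exact: measurable_I01.
  + by move=> y _; rewrite lee_fin betak_ge0.
  + apply: measurable_EFin; apply: subspace_continuous_measurable_fun.
      exact: measurable_I01.
    by apply: continuous_subspaceT; exact: continuous_betak.
  apply: eq_integral => u; rewrite inE /I01/= in_itv/= => /andP[u0 u1].
  rewrite -EFinM; congr EFin; rewrite /betak /=.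
  rewrite -[LHS]/(pospow (a - 1) (r * u) * pospow (b - 1) (r - r * u) * r).
  have -> : r - r * u = r * (1 - u) by ring.
  have u1' : 0 <= 1 - u by rewrite subr_ge0.
  have r0' := ltW r0.
  rewrite (pospowE _ (mulr_ge0 r0' u0)) (pospowE _ (mulr_ge0 r0' u1')).
  rewrite !pospowE// !powRM//.
  have -> : r `^ (a + b - 1) = r `^ (a - 1) * r `^ (b - 1) * r.
    rewrite -[X in _ * X]powRr1// -!powRD ?(gt_eqF r0) ?implybT//.
    by congr powR; ring.
  by ring.
- by move=> x y _ _ xy; rewrite ltr_pM2l.
- by rewrite F' => x _; exact: cst_continuous.
- by rewrite F'; exact: is_cvg_cst.
- by rewrite F'; exact: is_cvg_cst.
- have cF : continuous (fun u : R => r * u) by exact: mulrl_continuous.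
  split; first by move=> x _; exact: ex_derive.
    by apply: cvg_at_right_filter; exact: cF.
  by apply: cvg_at_left_filter; exact: cF.
- by apply: continuous_subspaceT; exact: continuous_betak.
Qed.

(** Insert [y + (1 - y) = 1] under the integral. *)
Lemma betaJ_sum a b : 1 < a -> 1 < b ->
  betaJ (a + 1) b + betaJ a (b + 1) = betaJ a b.
Proof.
move=> a1 b1; rewrite /betaJ -RintegralD; last 3 first.
- exact: measurable_I01.
- by apply: integrable_betak; lra.
- by apply: integrable_betak; lra.
apply: eq_Rintegral => y; rewrite inE /I01/= in_itv/= => /andP[y0 y1].
have y1' : 0 <= 1 - y by rewrite subr_ge0.
rewrite /betak !pospowE//.
have E c z : 0 <= z -> 1 < c -> z `^ (c + 1 - 1) = z `^ (c - 1) * z.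
  move=> z0 c1; rewrite mulrC mulr_powRB1//; last by lra.
  by congr powR; ring.
by rewrite !E//; ring.
Qed.

(** Integration by parts with the primitives [y ^ a] and [- (1 - y) ^ b]; the boundary terms vanish
    at 0 and at 1. *)
Lemma betaJ_parts a b : 1 < a -> 1 < b ->
  b * betaJ (a + 1) b = a * betaJ a (b + 1).
Proof.
move=> a1 b1.
have a0 : 0 < a by lra. have b0 : 0 < b by lra.
have dG y : y < 1 -> is_derive y 1 (fun y => - pospow b (1 - y)) (b * pospow (b - 1) (1 - y)).
  move=> y1.
  have H1 : is_derive (1 - y) 1 (pospow b) (b * pospow (b - 1) (1 - y)).
    by apply: is_derive_pospow; rewrite subr_gt0.
  have H2 : is_derive y (1 : R) (fun y : R => 1 - y) (- 1).
    by apply: is_derive_eq; ring.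
  have H3 := @is_derive1_comp _ (pospow b) (fun y => 1 - y) y _ _ H1 H2.
  have H4 := is_deriveN H3.
  by have -> : b * pospow (b - 1) (1 - y) = - (b * pospow (b - 1) (1 - y) * - 1) by ring.
have cF : continuous (pospow a) by exact: continuous_pospow.
have cG : continuous (fun y => - pospow b (1 - y)).
  by move=> y; apply: cvgN; exact: continuous_pospowB.
have H := @Rintegration_by_parts R (pospow a) (fun y => - pospow b (1 - y))
  (fun y => a * pospow (a - 1) y) (fun y => b * pospow (b - 1) (1 - y)) 0 1 ltr01; cbv beta in H.
have lr (F : R -> R) : continuous F -> (forall y, 0 < y < 1 -> derivable F y 1) ->
    derivable_oo_LRcontinuous F 0 1.
  move=> cF' dF; split; first by move=> y; rewrite in_itv/=; exact: dF.
    by apply: cvg_at_right_filter; exact: cF'.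
  by apply: cvg_at_left_filter; exact: cF'.
have -> : b * betaJ (a + 1) b = \int[mu]_(x in `[0, 1]) (pospow a x * (b * pospow (b - 1) (1 - x))).
  rewrite /betaJ -RintegralZl; [|exact: measurable_I01|by apply: integrable_betak; lra].
  apply: eq_Rintegral => y _; rewrite /betak.
  have -> : a + 1 - 1 = a by ring.
  by ring.
have E : \int[mu]_(x in `[0, 1]) (a * pospow (a - 1) x * - pospow b (1 - x)) =
    - a * betaJ a (b + 1).
  rewrite /betaJ -RintegralZl; [|exact: measurable_I01|by apply: integrable_betak; lra].
  apply: eq_Rintegral => y _; rewrite /betak.
  have -> : b + 1 - 1 = b by ring.
  by ring.
apply: etrans; [apply: H|].
- apply: continuous_subspaceT => y; apply: cvgM; first exact: cvg_cst.
  by apply: continuous_pospow; lra.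
- apply: lr => // y /andP[y0 _].
  by have [D _] := is_derive_pospow a y0.
- move=> y; rewrite in_itv/= => /andP[y0 _].
  by rewrite derive1E; have [_ ->] := is_derive_pospow a y0.
- apply: continuous_subspaceT => y; apply: cvgM; first exact: cvg_cst.
  by apply: continuous_pospowB; lra.
- apply: lr => // y /andP[_ y1].
  by have [D _] := dG y y1.
- move=> y; rewrite in_itv/= => /andP[_ y1].
  by rewrite derive1E; have [_ ->] := dG y y1.
- rewrite E subrr (pospow_eq0 b0 (lexx 0)) (pospow_eq0 a0 (lexx 0)) oppr0 mulr0 mul0r.
  by rewrite subrr sub0r mulNr opprK.
Qed.

(** [betaJ_sum] and [betaJ_parts] form a linear system in the two shifted values; solving it
    replaces the usual passage through the Gamma function. *)
Lemma betaJ_recl a b : 1 < a -> 1 < b ->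
  betaJ (a + 1) b = a / (a + b) * betaJ a b.
Proof.
move=> a1 b1; have ab0 : a + b != 0 by rewrite gt_eqF//; lra.
apply: (mulfI ab0); rewrite mulrA mulrCA divff// mulr1.
by rewrite mulrDl betaJ_parts// -mulrDr betaJ_sum.
Qed.

Lemma betaJ_recr a b : 1 < a -> 1 < b ->
  betaJ a (b + 1) = b / (a + b) * betaJ a b.
Proof.
move=> a1 b1; have ab0 : a + b != 0 by rewrite gt_eqF//; lra.
apply: (mulfI ab0); rewrite mulrA mulrCA divff// mulr1.
by rewrite mulrDl -betaJ_parts// -mulrDr betaJ_sum.
Qed.

End beta_integrals.

(** * Dirichlet normalizing constants and moments *)

Section dirichlet_integrals.
Context {R : realType}.
Local Notation mu := (@lebesgue_measure R).
Implicit Types (b : nat -> R).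

(** Unnormalized Dirichlet density. When all parameters exceed 1, the truncated powers vanish off
    the open simplex, which absorbs the indicator appearing in [dir_int]. *)
Definition dirker (K : nat) b (v : nat -> R) : R :=
  \prod_(k < K) pospow (b k - 1) (simplex_complete K v k).

Lemma dirkerE K b v : (forall k, (k < K)%N -> 1 < b k) ->
  dirker K b v = if simplex_interior K v
    then \prod_(k < K) simplex_complete K v k `^ (b k - 1) else 0.
Proof.
move=> b1; case: ifPn => [/forallP v0|/forallPn[k]].
  by apply: eq_bigr => k _; rewrite pospowE// ltW.
rewrite -leNgt => vk; rewrite /dirker (bigD1 k)//= pospow_eq0 ?mul0r//.
by rewrite subr_gt0 b1.
Qed.

Lemma dirker_ge0 K b v : 0 <= dirker K b v.
Proof. by apply: prodr_ge0 => k _; exact: pospow_ge0. Qed.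

(** Aggregation property of the Dirichlet law: the parameters obtained by lumping the categories [m]
    and [m.+1]. *)
Definition merge_last b (m : nat) : nat -> R :=
  fun k => if (k < m)%N then b k else b m + b m.+1.

(* Off by one: [dirZ K b] normalizes the Dirichlet density on [K.+1] categories. *)
Fixpoint dirZ (K : nat) b : R :=
  if K is m.+1 then betaJ (b m) (b m.+1) * dirZ m (merge_last b m) else 1.

(** The last two categories share the mass left over by the first [m], hence a Beta kernel whose
    range is that mass. *)
Lemma dirker_last m b v y :
  dirker m.+2 b (vset v m y) =
  \prod_(k < m) pospow (b k - 1) (v k) *
    betak (b m) (b m.+1) (1 - \sum_(j < m) v j) y.
Proof.
rewrite /dirker !big_ord_recr /= -mulrA; congr (_ * _).
  apply: eq_bigr => k _; rewrite /simplex_complete /= /vset ltnS ltnW ?ltn_ord//.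
  by rewrite ltn_eqF.
rewrite /betak /simplex_complete /= ltnS leqnn ltnn /vset eqxx; congr (_ * pospow _ _).
rewrite big_ord_recr /= eqxx opprD addrA; congr (_ - _ - _).
by apply: eq_bigr => j _; rewrite ltn_eqF.
Qed.

Lemma dirker_merge m b v :
  dirker m.+1 (merge_last b m) v =
  \prod_(k < m) pospow (b k - 1) (v k) *
    pospow (b m + b m.+1 - 1) (1 - \sum_(j < m) v j).
Proof.
rewrite /dirker !big_ord_recr /=; congr (_ * _).
  by apply: eq_bigr => k _; rewrite /simplex_complete /merge_last /= ltn_ord.
by rewrite /simplex_complete /merge_last /= ltnn.
Qed.

Lemma merge_last_gt1 m b : (forall k, (k < m.+2)%N -> 1 < b k) ->
  forall k, (k < m.+1)%N -> 1 < merge_last b m k.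
Proof.
move=> b1 k km; rewrite /merge_last; case: ifP => [km'|_].
  by apply: b1; rewrite ltnS ltnW.
by have := b1 m (leqnSn _); have := b1 m.+1 (ltnSn _) ; lra.
Qed.

(** The scaled Beta integral removes the innermost coordinate and leaves the kernel with merged
    parameters, its Beta constant joining the coefficient. Finite combinations are needed because
    the Markov majorant below has one kernel for each bin and side. *)
Lemma iint_dirker K (I : finType) (c : I -> R) (b : I -> nat -> R) :
  (forall j, 0 <= c j) -> (forall j k, (k < K.+1)%N -> 1 < b j k) ->
  iint K (fun v => (\sum_j c j * dirker K.+1 (b j) v)%:E) =
  (\sum_j c j * dirZ K (b j))%:E.
Proof.
elim: K c b => [|m IH] c b c0 b1.
  congr EFin; apply: eq_bigr => j _; rewrite /dirker big_ord1 /simplex_complete/=.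
  by rewrite big_ord0 subr0 pospowE// powR1.
rewrite iint_last.
transitivity (iint m (fun v => (\sum_j (c j * betaJ (b j m) (b j m.+1)) *
     dirker m.+1 (merge_last (b j) m) v)%:E)); last first.
  rewrite IH; first by congr EFin; apply: eq_bigr => j _ /=; rewrite mulrA.
    by move=> j; rewrite mulr_ge0 ?betaJ_ge0.
  by move=> j; apply: merge_last_gt1; exact: b1.
apply: eq_iint => v vI.
set r := 1 - \sum_(j < m) v j.
have r1 : r <= 1.
  rewrite lerBlDr lerDl; apply: sumr_ge0 => j _.
  by have := vI j (ltn_ord j); rewrite inE /I01/= in_itv/= => /andP[].
pose P j := \prod_(k < m) pospow (b j k - 1) (v k).
have P0 j : 0 <= P j by apply: prodr_ge0 => k _; exact: pospow_ge0.
have bm j : 1 < b j m by apply: b1; rewrite ltnS ltnW.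
have bm' j : 1 < b j m.+1 by exact: b1.
transitivity (\int[mu]_(y in I01) (\sum_j (c j * P j) * betak (b j m) (b j m.+1) r y)%:E)%E.
  by apply: eq_integral => y _; congr EFin; apply: eq_bigr => j _;
    rewrite dirker_last mulrA.
rewrite (integral_lincomb measurable_I01
  (t := fun j => pospow (b j m + b j m.+1 - 1) r * betaJ (b j m) (b j m.+1)))//.
- by congr EFin; apply: eq_bigr => j _; rewrite dirker_merge -/r -/(P j); ring.
- by move=> j; rewrite mulr_ge0.
- move=> j; apply: subspace_continuous_measurable_fun; first exact: measurable_I01.
  by apply: continuous_subspaceT; exact: continuous_betak.
- by move=> j y _; exact: betak_ge0.
- by move=> j; exact: integral_betak.
Qed.

Lemma eq_dirZ K b b' : (forall k, (k < K.+1)%N -> b k = b' k) -> dirZ K b = dirZ K b'.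
Proof.
elim: K b b' => // m IH b b' bb' /=.
have bm : b m = b' m by apply: bb'; exact: leqnSn.
have bm' : b m.+1 = b' m.+1 by exact: bb'.
rewrite bm bm'; congr (_ * _); apply: IH => k km.
by rewrite /merge_last bm bm'; case: ifP => // k'; apply: bb'; rewrite ltnS ltnW.
Qed.

Lemma dirZ_ge0 K b : 0 <= dirZ K b.
Proof. by elim: K b => //= m IH b; rewrite mulr_ge0 ?betaJ_ge0. Qed.

Definition bump_at b (k : nat) (x : R) : nat -> R :=
  fun j => if j == k then b j + x else b j.

Lemma sum_merge_last m b :
  \sum_(j < m.+1) merge_last b m j = \sum_(j < m.+2) b j.
Proof.
rewrite !big_ord_recr /= -addrA; congr (_ + _).
  by apply: eq_bigr => j _; rewrite /merge_last ltn_ord.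
by rewrite /merge_last ltnn.
Qed.

Lemma sum_gt1_gt0 K b : (forall j, (j < K.+1)%N -> 1 < b j) ->
  0 < \sum_(j < K.+1) b j.
Proof.
move=> b1; have b0 (j : 'I_K.+1) : 0 < b j by apply: lt_trans (b1 j _).
rewrite big_ord_recl ltr_wpDr// ?sumr_ge0// => j _; apply: ltW; exact: (b0 (lift ord0 j)).
Qed.

(** This is the Dirichlet mean of coordinate [k]. Bumping a category below [m] commutes with
    merging. Bumping one of the last two bumps the merged category, and the Beta recursion supplies
    the share of [b k] in [b m + b m.+1]. Merging preserves the total. *)
Lemma dirZ_bump1 K b k : (forall j, (j < K.+1)%N -> 1 < b j) -> (k < K.+1)%N ->
  dirZ K (bump_at b k 1) = b k / (\sum_(j < K.+1) b j) * dirZ K b.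
Proof.
elim: K b k => [|m IH] b k b1 km.
  have k0 : k = 0%N by case: k km.
  rewrite k0 big_ord1 divff ?mul1r// gt_eqF//.
  by have := b1 0%N (ltnSn _); lra.
have bm : 1 < b m by apply: b1; rewrite ltnS ltnW.
have bm' : 1 < b m.+1 by exact: b1.
have bs0 : b m + b m.+1 != 0 by rewrite gt_eqF//; lra.
have b1' := merge_last_gt1 b1.
rewrite /= -sum_merge_last.
have S0 : \sum_(j < m.+1) merge_last b m j != 0 by rewrite gt_eqF ?sum_gt1_gt0.
have [km'|mk] := ltnP k m.
  rewrite (eq_dirZ (b' := bump_at (merge_last b m) k 1)); last first.
    move=> j jm; rewrite /merge_last /bump_at; case: ltnP => // jm'.
    by rewrite (gtn_eqF km') (gtn_eqF (leqW km')) (gtn_eqF (leq_trans km' jm')).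
  rewrite IH//; last by rewrite ltnS ltnW.
  rewrite /bump_at (gtn_eqF km') (gtn_eqF (leqW km')) /merge_last km'.
  by ring.
have E : dirZ m (bump_at (merge_last b m) m 1) =
    (b m + b m.+1) / (\sum_(j < m.+1) merge_last b m j) * dirZ m (merge_last b m).
  by rewrite IH// /merge_last ltnn.
have [->|km2] := eqVneq k m.
  rewrite (eq_dirZ (b' := bump_at (merge_last b m) m 1)); last first.
    move=> j jm; rewrite /merge_last /bump_at; case: ltnP => jm'; first by rewrite ltn_eqF.
    have -> : j = m by apply/eqP; rewrite eqn_leq jm' andbT.
    by rewrite eqxx gtn_eqF//; ring.
  rewrite E /bump_at eqxx gtn_eqF// betaJ_recl//.
  by field; rewrite bs0 S0.
have -> : k = m.+1.
  by apply/eqP; rewrite eqn_leq -ltnS km ltn_neqAle eq_sym km2.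
rewrite (eq_dirZ (b' := bump_at (merge_last b m) m 1)); last first.
  move=> j jm; rewrite /merge_last /bump_at; case: ltnP => jm'.
    by rewrite !ltn_eqF// ltnS ltnW.
  have -> : j = m by apply/eqP; rewrite eqn_leq jm' andbT.
  by rewrite !eqxx ltn_eqF//; ring.
rewrite E /bump_at eqxx ltn_eqF// betaJ_recr//.
by field; rewrite bs0 S0.
Qed.

(** The moment of order [m] as a ratio of rising factorials: each unit bump raises both [b k] and
    the total by 1. *)
Lemma dirZ_bump K b k m : (forall j, (j < K.+1)%N -> 1 < b j) -> (k < K.+1)%N ->
  dirZ K (bump_at b k m%:R) =
  (\prod_(i < m) ((b k + i%:R) / (\sum_(j < K.+1) b j + i%:R))) * dirZ K b.
Proof.
move=> b1 kK; elim: m => [|m IH].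
  rewrite big_ord0 mul1r; apply: eq_dirZ => j _; rewrite /bump_at.
  by case: eqP; rewrite ?addr0.
rewrite (eq_dirZ (b' := bump_at (bump_at b k m%:R) k 1)); last first.
  by move=> j _; rewrite /bump_at; case: eqP => // _; rewrite -addrA natr1.
rewrite dirZ_bump1//; last first.
  move=> j jK; rewrite /bump_at; case: eqP => _; last exact: b1.
  by have := b1 j jK; have := ler0n R m; lra.
rewrite IH [in RHS]big_ord_recr/= mulrA; congr (_ * _); rewrite mulrC; congr (_ * (_ / _)).
  by rewrite /bump_at eqxx.
rewrite (bigD1 (Ordinal kK))//= [in RHS](bigD1 (Ordinal kK))//= /bump_at eqxx addrAC.
congr (_ + _ + _); apply: eq_bigr => j jk; rewrite ifN//.
Qed.

End dirichlet_integrals.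

(** * Histogram likelihood, conjugacy and domination of the posterior *)

Section histograms.
Context {R : realType}.
Implicit Types (w X : nat -> R) (L k n : nat).

Lemma inbin_ub L k (x : R) : inbin L k x -> x <= k.+1%:R * (2 ^+ L)^-1.
Proof. by rewrite /inbin; case: eqP => [->|_] /andP[_]; rewrite ?mul1r. Qed.

Lemma inbin_lb L k (x : R) : inbin L k x -> k%:R * (2 ^+ L)^-1 <= x.
Proof.
by rewrite /inbin; case: eqP => [->|_] /andP[x0 _]; rewrite ?mul0r// ltW.
Qed.

(** The bin is the least [k] whose right end is at or beyond [x]; minimality gives the strict
    inequality at the left end. *)
Lemma inbin_ex L (x : R) : x \in I01 -> exists k : 'I_(2 ^ L), inbin L k x.
Proof.
rewrite inE /I01/= in_itv/= => /andP[x0 x1].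
have K0 : 0 < (2 : R) ^+ L by rewrite exprn_gt0.
have P : exists k, x <= k.+1%:R * (2 ^+ L)^-1.
  exists (2 ^ L).-1; rewrite prednK ?expn_gt0// natrX divff//.
have kL : (ex_minn P < 2 ^ L)%N.
  case: ex_minnP => k _ kmin; rewrite -(prednK (n := 2 ^ L)) ?expn_gt0// ltnS.
  by apply: kmin; rewrite prednK ?expn_gt0// natrX divff.
exists (Ordinal kL) => /=; case: ex_minnP => -[|k] xk kmin.
  by rewrite /inbin eqxx x0 -[X in _ <= X]mul1r.
rewrite /inbin/= xk andbT ltNge; apply/negP => /kmin.
by rewrite ltnn.
Qed.

Lemma inbin_inj L k k' (x : R) : inbin L k x -> inbin L k' x -> k = k'.
Proof.
wlog kk' : k k' / (k <= k')%N.
  by move=> H; case/orP: (leq_total k k') => [/H//|/H{}H] a b; rewrite (H b a).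
move=> /inbin_ub xk xk'; apply/eqP; rewrite eqn_leq kk'/= leqNgt; apply/negP => lt.
move: xk'; rewrite /inbin gtn_eqF ?(leq_ltn_trans _ lt)// => /andP[+ _].
rewrite ltNge => /negP; apply; apply: le_trans xk _.
by rewrite ler_pM2r ?invr_gt0 ?exprn_gt0// ler_nat.
Qed.

Lemma hist_inbin L (k : 'I_(2 ^ L)) w x : inbin L k x -> hist L w x = 2 ^+ L * w k.
Proof.
move=> xk; rewrite /hist (bigD1 k)//= xk mulr1 big1 ?addr0// => j jk.
case: (boolP (inbin L j x)) => [xj|_]; last by rewrite mulr0.
by move: jk; rewrite -val_eqE/= (inbin_inj xj xk) eqxx.
Qed.

Definition cnt L n X k : nat := (\sum_(i < n) inbin L k (X i))%N.

(** Each observation lies in exactly one bin, so the likelihood is multinomial in the counts. *)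
Lemma prod_hist L n X w : (forall i, (i < n)%N -> X i \in I01) ->
  \prod_(i < n) hist L w (X i) =
  (2 ^+ L) ^+ n * \prod_(k < 2 ^ L) w k ^+ cnt L n X k.
Proof.
move=> XI; transitivity
  (\prod_(i < n) (2 ^+ L * \prod_(k < 2 ^ L) w k ^+ inbin L k (X i))).
  apply: eq_bigr => i _; have [k Xk] := inbin_ex L (XI i (ltn_ord i)).
  rewrite (hist_inbin _ Xk); congr (_ * _).
  rewrite (bigD1 k)//= Xk expr1 big1 ?mulr1// => j jk.
  case: (boolP (inbin L j (X i))) => // Xj.
  by move: jk; rewrite -val_eqE/= (inbin_inj Xj Xk) eqxx.
rewrite big_split /= prodr_const card_ord; congr (_ * _).
by rewrite exchange_big/=; apply: eq_bigr => k _; rewrite prodrXr.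
Qed.

Lemma sum_cnt L n X : (forall i, (i < n)%N -> X i \in I01) ->
  (\sum_(k < 2 ^ L) cnt L n X k = n)%N.
Proof.
move=> XI; rewrite /cnt exchange_big/= -[RHS]card_ord -sum1_card.
apply: eq_bigr => i _; have [k Xk] := inbin_ex L (XI i (ltn_ord i)).
rewrite (bigD1 k)//= Xk big1// => j jk.
case: (boolP (inbin L j (X i))) => // Xj.
by move: jk; rewrite -val_eqE/= (inbin_inj Xj Xk) eqxx.
Qed.

Lemma dir_int_ge0 K (a : nat -> R) (g : (nat -> R) -> R) :
  (forall v, simplex_interior K v -> 0 <= g (simplex_complete K v)) ->
  (0 <= dir_int K a g)%E.
Proof.
move=> g0; apply: (le_iint (G := cst +oo%E) _ _).1 => v _; last by rewrite leey.
case: ifPn => // vI; rewrite lee_fin mulr_ge0 ?g0//.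
by apply: prodr_ge0 => k _; exact: powR_ge0.
Qed.

Lemma le_dir_int K (a : nat -> R) (g h : (nat -> R) -> R) :
  (forall v, simplex_interior K v -> 0 <= g (simplex_complete K v)) ->
  (forall v, simplex_interior K v ->
     g (simplex_complete K v) <= h (simplex_complete K v)) ->
  (dir_int K a g <= dir_int K a h)%E.
Proof.
move=> g0 gh; apply: (le_iint _ _).2 => v _; case: ifPn => // vI.
  rewrite lee_fin mulr_ge0 ?g0//.
  by apply: prodr_ge0 => k _; exact: powR_ge0.
rewrite lee_fin ler_wpM2r ?gh//.
by apply: prodr_ge0 => k _; exact: powR_ge0.
Qed.

Lemma hist_ge0 L (v : nat -> R) (x : R) : simplex_interior (2 ^ L) v ->
  0 <= hist L (simplex_complete (2 ^ L) v) x.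
Proof.
move=> /forallP v0; rewrite /hist mulr_ge0 ?exprn_ge0//.
by apply: sumr_ge0 => k _; rewrite mulr_ge0 ?ler0n// ltW.
Qed.

Lemma le_fine_ge0 (x y : \bar R) : (0 <= x)%E -> (x <= y)%E ->
  y \is a fin_num -> fine x <= fine y.
Proof.
move=> x0 xy yf; apply: fine_le => //.
by rewrite ge0_fin_numE// (le_lt_trans xy)// -ge0_fin_numE// (le_trans x0).
Qed.

(** The prior normalizing constant cancels from the quotient. Only an inequality is claimed: should
    that constant evaluate to 0, the posterior is 0 by the convention on division. *)
Lemma hist_posterior_le L (a : nat -> R) n X (B : set (R -> R)) :
  0 <= hist_posterior L a n X B <=
  fine (dir_int (2 ^ L) a (fun w => (hist L w \in B)%:R * \prod_(i < n) hist L w (X i)))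
  / fine (dir_int (2 ^ L) a (fun w => \prod_(i < n) hist L w (X i))).
Proof.
rewrite /hist_posterior /dir_expect.
set x := fine (dir_int _ _ (fun w => _ * _)); set y := fine (dir_int _ _ (fun w => \prod_(i < n) _)).
set z := fine _.
have x0 : 0 <= x.
  apply: fine_ge0; apply: dir_int_ge0 => v vI; rewrite mulr_ge0 ?ler0n//.
  by apply: prodr_ge0 => i _; exact: hist_ge0.
have y0 : 0 <= y.
  apply: fine_ge0; apply: dir_int_ge0 => v vI.
  by apply: prodr_ge0 => i _; exact: hist_ge0.
have [->|z0] := eqVneq z 0; first by rewrite invr0 !mulr0 mul0r lexx/= divr_ge0.
have -> : x / z / (y / z) = x / y.
  have [->|yn0] := eqVneq y 0; first by rewrite mul0r invr0 !mulr0.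
  by field; rewrite yn0 z0.
by rewrite lexx andbT divr_ge0.
Qed.

Lemma hist_posterior_le1 L (a : nat -> R) n X (B : set (R -> R)) :
  hist_posterior L a n X B <= 1.
Proof.
have /andP[_] := hist_posterior_le L a n X B; move/le_trans; apply.
set x := dir_int _ _ (fun w => _ * _); set y := dir_int _ _ _.
have P0 v : simplex_interior (2 ^ L) v ->
    0 <= \prod_(i < n) hist L (simplex_complete (2 ^ L) v) (X i).
  by move=> vI; apply: prodr_ge0 => i _; exact: hist_ge0.
have x0 : (0 <= x)%E.
  by apply: dir_int_ge0 => v vI; rewrite mulr_ge0 ?ler0n// P0.
have xy : (x <= y)%E.
  apply: le_dir_int => v vI; first by rewrite mulr_ge0 ?ler0n// P0.
  by rewrite ler_piMl ?P0// lern1 leq_b1.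
(* If the evidence is infinite, [fine] sends it to 0 and the quotient is 0. *)
have [yf|] := boolP (y \is a fin_num).
  have [y0|y0] := eqVneq (fine y) 0; first by rewrite y0 invr0 mulr0.
  have y0' : 0 < fine y by rewrite lt_def y0 fine_ge0// (le_trans x0).
  by rewrite ler_pdivrMr// mul1r le_fine_ge0.
have : (0 <= y)%E by exact: le_trans xy.
by case: y {xy} => //= _ _; rewrite invr0 mulr0.
Qed.

(** Conjugacy: the powers [cnt] of the likelihood add to the prior exponents, giving the Dirichlet
    kernel with parameters [A]. *)
Lemma dir_int_hist L (a : nat -> R) n X (g : (nat -> R) -> R)
    (A := fun k => a k + (cnt L n X k)%:R) :
  (forall i, (i < n)%N -> X i \in I01) ->
  (forall k, (k < 2 ^ L)%N -> 1 < A k) ->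
  dir_int (2 ^ L) a (fun w => g w * \prod_(i < n) hist L w (X i)) =
  iint (2 ^ L).-1 (fun v => ((2 ^+ L) ^+ n *
     (g (simplex_complete (2 ^ L) v) * dirker (2 ^ L) A v))%:E).
Proof.
move=> XI A1; apply: eq_iint => v _; rewrite dirkerE//.
case: ifPn => [/forallP v0|_]; last by rewrite !mulr0.
rewrite prod_hist//; congr EFin; rewrite -!mulrA mulrCA; congr (_ * (_ * _)).
rewrite -big_split /=; apply: eq_bigr => k _.
rewrite -powR_mulrn ?ltW// -powRD ?(gt_eqF (v0 k)) ?implybT//.
by congr powR; rewrite /A; ring.
Qed.

(** The frame for Markov's inequality: dominating the posterior kernel on [B] by other Dirichlet
    kernels bounds the posterior mass by a ratio of explicit constants, through monotonicity of
    [iint]. *)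
Lemma hist_posterior_dirZ L (a : nat -> R) n X (B : set (R -> R))
    (A := fun k => a k + (cnt L n X k)%:R)
    (I : finType) (c : I -> R) (b : I -> nat -> R) :
  (forall i, (i < n)%N -> X i \in I01) ->
  (forall k, (k < 2 ^ L)%N -> 1 < A k) ->
  (forall j, 0 <= c j) -> (forall j k, (k < 2 ^ L)%N -> 1 < b j k) ->
  (forall v, simplex_interior (2 ^ L) v ->
     hist L (simplex_complete (2 ^ L) v) \in B ->
     dirker (2 ^ L) A v <= \sum_j c j * dirker (2 ^ L) (b j) v) ->
  hist_posterior L a n X B <=
  (\sum_j c j * dirZ (2 ^ L).-1 (b j)) / dirZ (2 ^ L).-1 A.
Proof.
move=> XI A1 c0 b1 dom.
have K0 : (2 ^ L).-1.+1 = (2 ^ L)%N by rewrite prednK// expn_gt0.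
have /andP[_] := hist_posterior_le L a n X B; move/le_trans; apply.
set C : R := (2 ^+ L) ^+ n; have C0 : 0 < C by rewrite !exprn_gt0.
have Z (J : finType) (d : J -> R) (e : J -> nat -> R) : (forall j, 0 <= d j) ->
    (forall j k, (k < 2 ^ L)%N -> 1 < e j k) ->
    iint (2 ^ L).-1 (fun v => (\sum_j d j * dirker (2 ^ L) (e j) v)%:E) =
    (\sum_j d j * dirZ (2 ^ L).-1 (e j))%:E.
  by move=> d0 e1; have := @iint_dirker R (2 ^ L).-1 J d e; rewrite K0; exact.
have -> : dir_int (2 ^ L) a (fun w => \prod_(i < n) hist L w (X i)) =
    (C * dirZ (2 ^ L).-1 A)%:E.
  transitivity (dir_int (2 ^ L) a (fun w => 1 * \prod_(i < n) hist L w (X i))).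
    by congr dir_int; apply/funext => w; rewrite mul1r.
  rewrite (dir_int_hist (fun=> 1) XI A1)// -/A -/C.
  (* A one-term sum, so that the formula for combinations also gives the denominator. *)
  transitivity (iint (2 ^ L).-1 (fun v => (\sum_(j : unit) C * dirker (2 ^ L) A v)%:E)).
    by apply: eq_iint => v _; rewrite big_const card_unit/= addr0 mul1r.
  by rewrite Z ?big_const ?card_unit/= ?addr0// => _; exact: ltW.
rewrite (dir_int_hist (fun w => (hist L w \in B)%:R) XI A1)// -/A -/C.
have D0 := dirker_ge0 (2 ^ L) A.
have I0 : (0 <= iint (2 ^ L).-1 (fun v => (C * ((hist L (simplex_complete (2 ^ L) v) \in B)%:R *
     dirker (2 ^ L) A v))%:E))%E /\
  (iint (2 ^ L).-1 (fun v => (C * ((hist L (simplex_complete (2 ^ L) v) \in B)%:R *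
     dirker (2 ^ L) A v))%:E) <= (C * \sum_j c j * dirZ (2 ^ L).-1 (b j))%:E)%E.
  have -> : C * (\sum_j c j * dirZ (2 ^ L).-1 (b j)) =
      \sum_j (C * c j) * dirZ (2 ^ L).-1 (b j).
    by rewrite mulr_sumr; apply: eq_bigr => j _; rewrite mulrA.
  rewrite -Z//; last by move=> j; rewrite mulr_ge0// ltW.
  apply: le_iint => v _; rewrite lee_fin.
    by rewrite mulr_ge0 ?(ltW C0)// mulr_ge0 ?ler0n.
  under [leRHS]eq_bigr do rewrite -mulrA.
  rewrite -mulr_sumr ler_pM2l//.
  have S0 : 0 <= \sum_j c j * dirker (2 ^ L) (b j) v.
    by apply: sumr_ge0 => j _; rewrite mulr_ge0 ?dirker_ge0.
  have [vB|vB] := boolP (_ \in B); last by rewrite mul0r.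
  rewrite mul1r; have [vI|vI] := boolP (simplex_interior (2 ^ L) v); first exact: dom.
  by rewrite dirkerE// (negbTE vI).
have [J2 J1] := I0; move: J1 J2; set J := iint _ _ => J1 J2.
have Jle : fine J <= C * \sum_j c j * dirZ (2 ^ L).-1 (b j).
  by rewrite (le_trans (le_fine_ge0 J2 J1 _)).
rewrite (@le_trans _ _ ((C * \sum_j c j * dirZ (2 ^ L).-1 (b j)) / (C * dirZ (2 ^ L).-1 A)))//.
  by rewrite ler_wpM2r// invr_ge0/= mulr_ge0 ?dirZ_ge0// ltW.
by rewrite -mulf_div divff ?mul1r// gt_eqF.
Qed.

End histograms.

(** * Posterior tails for well-behaved counts *)

Section posterior_tails.
Context {R : realType}.

Lemma dirker_bump K (b : nat -> R) k m v : (k < K)%N -> 0 < simplex_complete K v k ->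
  dirker K (bump_at b k m%:R) v = simplex_complete K v k ^+ m * dirker K b v.
Proof.
move=> kK w0; rewrite /dirker (bigD1 (Ordinal kK))//= [in RHS](bigD1 (Ordinal kK))//= mulrA.
congr (_ * _); last by apply: eq_bigr => j jk; rewrite /bump_at ifN.
rewrite /bump_at eqxx !pospowE ?ltW// -powR_mulrn ?ltW//.
by rewrite -powRD ?(gt_eqF w0) ?implybT//; congr powR; ring.
Qed.

(** Lets [dirker_bump] be read backwards, from the lowered parameter to [b], which produces the
    negative moments. *)
Lemma bump_atK (b : nat -> R) k (x : R) : bump_at (bump_at b k (- x)) k x = b.
Proof. by apply/funext => j; rewrite /bump_at; case: eqP => // _; rewrite subrK. Qed.

Lemma prod_le_expr m (F : 'I_m -> R) (r : R) :
  (forall i, 0 <= F i <= r) -> \prod_i F i <= r ^+ m.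
Proof.
move=> Fr; rewrite -[X in r ^+ X]card_ord -prodr_const.
exact: ler_prod.
Qed.

(** One factor of the moment of order [m], divided by the upper threshold. The margin [7 * D + 5]
    pays [2 * D + 3] for the deviation of [A], 1 for [i], and at most [4 * D + 1] for the gain
    [1 - 4 * e]. *)
Lemma ratio_upper (D e y P A i S K : R) :
  0 < D -> 0 < e -> 0 < y -> 0 < K -> 0 < P <= D -> 4 * e * (7 * D + 5) <= 1 ->
  0 <= i <= e * y -> 0 < A <= P * y + (2 * D + 3) * (e * y) -> K * y <= S ->
  0 <= (A + i) / (S + i) / ((P + (7 * D + 5) * e) / K) <= 1 - 4 * e.
Proof.
move=> D0 e0 y0 K0 /andP[P0 PD] eD /andP[i0 ie] /andP[A0 AP] SK.
have q0 : 0 < P + (7 * D + 5) * e by rewrite addr_gt0// mulr_gt0//; lra.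
have Ky0 : 0 < K * y by rewrite mulr_gt0.
have S0 : 0 < S + i by lra.
have e4 : 0 <= 1 - 4 * e.
  have : 0 <= e * D by rewrite mulr_ge0 ?ltW.
  by lra.
apply/andP; split; first by rewrite !divr_ge0 ?ltW//; lra.
rewrite ler_pdivrMr ?divr_gt0// ler_pdivrMr//.
have h1 : (P + (7 * D + 5) * e) * y <= (P + (7 * D + 5) * e) / K * (S + i).
  rewrite -mulrA ler_pM2l// mulrC ler_pdivlMr//; lra.
rewrite -mulrA; apply: le_trans (ler_wpM2l e4 h1).
have h2 : e * y * P <= e * y * D by rewrite ler_wpM2l// mulr_ge0 ?ltW.
have h3 : (e * y) * (4 * e * (7 * D + 5)) <= e * y * 1.
  by rewrite ler_wpM2l// mulr_ge0 ?ltW.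
have h4 : 0 <= e * y * D by rewrite !mulr_ge0 ?ltW.
lra.
Qed.

(** One factor of the moment of order [- m], multiplied by the lower threshold. The margin pays
    [2 * D + 3] for the deviation of [A] and for [m], [4 * D] for the gain, and [D] for the prior
    mass [c * K] in the total [S]. *)
Lemma ratio_lower (D e y P A m i S K c : R) :
  0 < D -> 0 < e -> 0 < y -> 0 < K -> (7 * D + 5) * e < P <= D ->
  4 * e * (7 * D + 5) <= 1 -> 0 <= i <= m -> m <= e * y -> 0 <= c <= e * y ->
  P * y - (2 * D + 2) * (e * y) <= A -> A <= S -> S <= K * y + c * K ->
  0 <= (S - m + i) / (A - m + i) * ((P - (7 * D + 5) * e) / K) <= 1 - 4 * e.
Proof.
move=> D0 e0 y0 K0 /andP[P0 PD] eD /andP[i0 im] me /andP[c0 ce] AP AS SK.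
have ey0 : 0 < e * y by rewrite mulr_gt0.
have Py : (7 * D + 5) * (e * y) < P * y by rewrite mulrA ltr_pM2r.
have De : 0 < D * (e * y) by rewrite mulr_gt0.
have Am : P * y - (2 * D + 3) * (e * y) <= A - m + i by lra.
have Am0 : 0 < A - m + i by lra.
have q0 : 0 < P - (7 * D + 5) * e by lra.
have e4 : 0 <= 1 - 4 * e.
  have : 0 <= e * D by rewrite mulr_ge0 ?ltW.
  by lra.
apply/andP; split; first by rewrite mulr_ge0 ?divr_ge0 ?ltW//; lra.
rewrite mulrAC ler_pdivrMr//; apply: le_trans (ler_wpM2l e4 Am).
have h1 : (S - m + i) * ((P - (7 * D + 5) * e) / K) <= (P - (7 * D + 5) * e) * (y + c).
  rewrite mulrA ler_pdivrMr// mulrC -mulrA ler_pM2l//; lra.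
apply: le_trans h1 _.
have h2 : e * y * P <= e * y * D by rewrite ler_wpM2l// ltW.
have h3 : P * c <= D * (e * y).
  by rewrite ler_pM// ltW// (lt_trans _ P0)// mulr_gt0//; lra.
have h4 : 0 <= (7 * D + 5) * e * c by rewrite mulr_ge0// mulr_ge0 ?(ltW e0)//; lra.
have h5 : 0 <= e * (e * y) * (2 * D + 3) by rewrite !mulr_ge0 ?ltW//; lra.
lra.
Qed.

(** By [1 - 4 * e <= expR (- (4 * e))], as [4 * e * m >= 2 * e * x >= 2 * ln n]. *)
Lemma one_sub_expr_le (e x : R) (n m : nat) : 0 < e -> 4 * e <= 1 -> (0 < n)%N ->
  x / 2 <= m%:R -> ln n%:R <= e * x -> (1 - 4 * e) ^+ m <= (n%:R ^+ 2)^-1.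
Proof.
move=> e0 e4 n0 xm nx.
have n0' : 0 < n%:R :> R by rewrite ltr0n.
apply: (@le_trans _ _ (expR (- (4 * e)) ^+ m)).
  by rewrite lerXn2r ?nnegrE ?expR_ge0 ?subr_ge0// expR_ge1Dx.
rewrite -expRM_natl -[n%:R in leRHS]lnK ?posrE//.
rewrite -expRM_natl -expRN ler_expR mulrN lerN2.
have : (e * 4) * (x / 2) <= (e * 4) * m%:R by rewrite ler_pM2l// mulr_gt0.
by lra.
Qed.

(** The deterministic half, for a sample whose counts are all close to their means. Here [y] is the
    average count per bin, and an index [j] is a bin together with a side, [true] standing for the
    upper tail. *)
Lemma hist_posterior_good L n (X a p : nat -> R) (c2 D e y rho : R)
    (B : set (R -> R)) (K : R := 2 ^+ L) :
  y = n%:R / K -> (0 < n)%N -> 0 < D -> 0 < e -> 0 <= c2 <= e * y -> 2 <= e * y ->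
  4 * e * (7 * D + 5) <= 1 -> (7 * D + 5) * e < rho ->
  ln n%:R <= e * (e * y) ->
  (forall i, (i < n)%N -> X i \in I01) ->
  (forall k, (k < 2 ^ L)%N -> 0 <= a k <= c2) ->
  (forall k, (k < 2 ^ L)%N -> rho <= K * p k <= D) ->
  (forall k, (k < 2 ^ L)%N ->
     `|(cnt L n X k)%:R - n%:R * p k| <= (2 * D + 2) * (e * y)) ->
  (forall w, hist L w \in B -> exists k : 'I_(2 ^ L),
     (p k + (7 * D + 5) * e / K < w k) \/ (w k < p k - (7 * D + 5) * e / K)) ->
  hist_posterior L a n X B <= \sum_(j : 'I_(2 ^ L) * bool) (n%:R ^+ 2)^-1.
Proof.
move=> yE n0 D0 e0 /andP[c20 c2x] x2 eD erho lnx XI a0 pK good HB.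
have K0 : 0 < K by rewrite exprn_gt0.
have n0' : 0 < n%:R :> R by rewrite ltr0n.
have y0 : 0 < y by rewrite yE divr_gt0.
have nE : n%:R = K * y by rewrite yE mulrC divfK ?gt_eqF.
pose A k := a k + (cnt L n X k)%:R.
pose P k := K * p k.
have npE k : n%:R * p k = P k * y by rewrite nE /P; ring.
have PD k : (k < 2 ^ L)%N -> rho <= P k <= D by exact: pK.
have ey0 : 0 < e * y by rewrite mulr_gt0.
have Al k : (k < 2 ^ L)%N -> P k * y - (2 * D + 2) * (e * y) <= A k.
  move=> kL; have /andP[ak0 _] := a0 k kL.
  have := good k kL; rewrite npE ler_norml => /andP[+ _]; rewrite /A; lra.
have Au k : (k < 2 ^ L)%N -> A k <= P k * y + (2 * D + 3) * (e * y).
  move=> kL; have /andP[_ akc] := a0 k kL.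
  have := good k kL; rewrite npE ler_norml => /andP[_ +]; rewrite /A; lra.
(* Since [e * y >= 2], truncation loses at most half; and [m <= e * y] keeps [A k - m] above 1, so
   that the negative moments are finite. *)
set m := Num.truncn (e * y).
have /andP[mle mgt] : m%:R <= e * y < m.+1%:R by exact: truncn_itv (ltW ey0).
have mge : e * y / 2 <= m%:R by move: mgt; rewrite -natr1; lra.
have Py k : (k < 2 ^ L)%N -> (7 * D + 5) * (e * y) < P k * y.
  by move=> kL; rewrite mulrA ltr_pM2r//; have /andP[+ _] := PD k kL; lra.
have De : 0 < D * (e * y) by rewrite mulr_gt0.
have Am k : (k < 2 ^ L)%N -> 1 < A k - m%:R.
  by move=> kL; have := Al k kL; have := Py k kL; lra.
have A1 k : (k < 2 ^ L)%N -> 1 < A k.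
  by move=> kL; have := Am k kL; have := ler0n R m; lra.
(* Markov weights: the upper threshold to the power [- m], the lower one to the power [m]. *)
pose c (j : 'I_(2 ^ L) * bool) : R :=
  if j.2 then (((P j.1 + (7 * D + 5) * e) / K)^-1) ^+ m
  else ((P j.1 - (7 * D + 5) * e) / K) ^+ m.
pose b (j : 'I_(2 ^ L) * bool) : nat -> R :=
  bump_at A j.1 (if j.2 then m%:R else - m%:R).
have qu (k : 'I_(2 ^ L)) : 0 < (P k + (7 * D + 5) * e) / K.
  rewrite divr_gt0//; have /andP[+ _] := PD k (ltn_ord k).
  have : 0 < e * D by rewrite mulr_gt0.
  by lra.
have ql (k : 'I_(2 ^ L)) : 0 < (P k - (7 * D + 5) * e) / K.
  by rewrite divr_gt0//; have /andP[+ _] := PD k (ltn_ord k); lra.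
have c0 j : 0 <= c j.
  by rewrite /c; case: ifP => _; rewrite exprn_ge0// ?invr_ge0 ltW.
have b1 j k : (k < 2 ^ L)%N -> 1 < b j k.
  move=> kL; rewrite /b /bump_at; case: eqP => _; last exact: A1.
  have := Am k kL; have := A1 k kL; have := ler0n R m.
  by case: ifP => _; lra.
have KE : (2 ^ L).-1.+1 = (2 ^ L)%N by rewrite prednK// expn_gt0.
pose S := \sum_(k < 2 ^ L) A k.
have SE : S = \sum_(k < 2 ^ L) a k + n%:R.
  by rewrite /S big_split/= -natr_sum sum_cnt.
have Sge : K * y <= S.
  by rewrite SE -nE lerDr sumr_ge0// => k _; have /andP[] := a0 k (ltn_ord k).
have Sle : S <= K * y + c2 * K.
  rewrite SE -nE addrC lerD2l; apply: (@le_trans _ _ (\sum_(k < 2 ^ L) c2)).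
    by apply: ler_sum => k _; have /andP[] := a0 k (ltn_ord k).
  by rewrite sumr_const card_ord -[leLHS]mulr_natr natrX.
have AS (k : 'I_(2 ^ L)) : A k <= S.
  rewrite /S (bigD1 k)//= lerDl sumr_ge0// => j _.
  by have := A1 j (ltn_ord j); lra.
have eD0 : 0 < e * D by rewrite mulr_gt0.
have e4 : 4 * e <= 1 by lra.
have b1' d : (forall k, (k < 2 ^ L)%N -> 1 < d k) -> forall j, (j < (2 ^ L).-1.+1)%N -> 1 < d j :> R.
  by move=> d1 j; rewrite KE; exact: d1.
apply: le_trans (hist_posterior_dirZ XI A1 c0 b1 _) _.
  move=> v /forallP vI vB.
  have [k wk] := HB _ vB; set w := simplex_complete (2 ^ L) v in vI wk *.
  have D00 j : 0 <= c j * dirker (2 ^ L) (b j) v by rewrite mulr_ge0 ?dirker_ge0.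
  have wk0 := vI k.
  (* At the deviating coordinate, the ratio of [w k] to its threshold, or its inverse, is at least 1
     to the power [m], so a single term of the sum already dominates. *)
  case: wk => wk.
    apply: (@le_trans _ _ (c (k, true) * dirker (2 ^ L) (b (k, true)) v)); last first.
      by rewrite (bigD1 (k, true))//= lerDl sumr_ge0.
    rewrite /c /b/= dirker_bump// mulrA -/w -exprMn ler_peMl ?dirker_ge0//.
    rewrite exprn_ege1// mulrC ler_pdivlMr ?mul1r// mulrDl {1}/P.
    by rewrite [K * _]mulrC mulfK ?gt_eqF// ltW.
  apply: (@le_trans _ _ (c (k, false) * dirker (2 ^ L) (b (k, false)) v)); last first.
    by rewrite (bigD1 (k, false))//= lerDl sumr_ge0.
  rewrite /c /b/= -[leLHS]/(dirker (2 ^ L) A v) -[in leLHS](bump_atK A k m%:R).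
  rewrite dirker_bump// -/w.
  rewrite ler_wpM2r ?dirker_ge0// lerXn2r ?nnegrE ?(ltW wk0) ?(ltW (ql k))//.
  by rewrite mulrBl {1}/P [K * _]mulrC mulfK ?gt_eqF// ltW.
rewrite mulr_suml; apply: ler_sum => -[k s] _.
have rh : 0 <= (n%:R ^+ 2)^-1 :> R by rewrite invr_ge0 exprn_ge0.
have Z0 := dirZ_ge0 (2 ^ L).-1 A.
(* If the normalizing constant were 0, the quotient would be 0 by convention. *)
have [Z|Zn0] := eqVneq (dirZ (2 ^ L).-1 A) 0; first by rewrite -/A Z invr0 mulr0.
rewrite -/A; apply: (@le_trans _ _ ((1 - 4 * e) ^+ m)); last first.
  exact: (one_sub_expr_le e0 e4 n0 mge lnx).
have iord (i : 'I_m) : (0 <= i%:R :> R) && (i%:R <= m%:R :> R) by rewrite ler0n ler_nat ltnW.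
have /andP[Prho PDk] := PD k (ltn_ord k).
have rho0 : 0 < rho.
  apply: lt_trans erho; have : 0 < e * D by rewrite mulr_gt0.
  by lra.
case: s; rewrite /c /b/=.
  rewrite (dirZ_bump _ (b1' _ A1)) ?KE//.
  rewrite mulrA mulfK// exprVn -exprVn.
  rewrite -[X in _ ^+ X]card_ord -prodr_const -big_split/=.
  apply: prod_le_expr => i; rewrite mulrC.
  have /andP[i0 im] := iord i.
  have Pk0 : 0 < P k by exact: lt_le_trans Prho.
  have Ak0 : 0 < A k by apply: lt_trans (A1 k _).
  apply: (@ratio_upper D e y (P k) (A k) i%:R S K); rewrite // ?Pk0 ?i0 ?Ak0 ?Au//=.
  exact: le_trans mle.
have bm1 : forall j, (j < (2 ^ L).-1.+1)%N -> 1 < bump_at A k (- m%:R) j.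
  by apply: b1' => j jL; exact: (b1 (k, false)).
(* The moment formula starts from the lowered parameter and ends at [A], so the negative moment is
   the inverse of the product [Pr]. *)
have := dirZ_bump m bm1 (k := k); rewrite bump_atK KE ltn_ord => /(_ isT) ZE.
have SmE : \sum_(j < 2 ^ L) bump_at A k (- m%:R) j = S - m%:R.
  rewrite /S (bigD1 k)//= [in RHS](bigD1 k)//= /bump_at eqxx addrAC.
  by congr (_ + _ + _); apply: eq_bigr => j jk; rewrite ifN.
move: ZE; rewrite SmE {1}/bump_at eqxx.
set Zb := dirZ _ (bump_at _ _ _); set Pr := \prod_(i < m) _ => ZE.
have Pr0 : Pr != 0 by apply: contra_neq Zn0 => Pr0; rewrite ZE Pr0 mul0r.
have Zb0 : Zb != 0 by apply: contra_neq Zn0 => Zb0; rewrite ZE Zb0 mulr0.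
rewrite ZE invfM mulrA [_ * Zb / _]mulrAC mulfK//.
rewrite /Pr -prodfV -[X in _ ^+ X]card_ord -prodr_const -big_split/=.
apply: prod_le_expr => i; rewrite invf_div mulrC.
have lP : (7 * D + 5) * e < P k by exact: lt_le_trans Prho.
by apply: (@ratio_lower D e y (P k) (A k) m%:R i%:R S K c2);
  rewrite // ?iord ?lP ?PDk ?c20 ?c2x ?Al.
Qed.

End posterior_tails.

(** * Bin probabilities and exponential moments of the counts *)

Section counts.
Context {R : realType}.
Local Notation mu := (@lebesgue_measure R).
Context (f0 : R -> R) (df0 : density01 f0).

Definition binset (L k : nat) : set R := [set x | inbin L k x].

(** Only bin 0 contains its left end, whence the boolean in [BSide]. *)
Lemma binsetE L k : binset L k =
  [set` Interval (BSide (k == 0%N) (k%:R * (2 ^+ L)^-1)) (BRight (k.+1%:R * (2 ^+ L)^-1))].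
Proof.
apply/seteqP; split=> x; rewrite /binset /inbin/= itv_boundlr /=;
  by case: eqP => [->|_]; rewrite ?mul0r ?mul1r.
Qed.

Lemma measurable_binset L k : measurable (binset L k).
Proof. by rewrite binsetE; exact: measurable_itv. Qed.

Lemma mu_binset L k : mu (binset L k) = ((2 ^+ L)^-1)%:E.
Proof.
rewrite binsetE lebesgue_measure_itv/= lte_fin.
have K0 : 0 < (2 ^+ L)^-1 :> R by rewrite invr_gt0 exprn_gt0.
by rewrite ltr_pM2r// ltr_nat ltnSn -EFinB -mulrBl -natrB// subSnn mul1r.
Qed.

Lemma binset_sub L (k : nat) : (k < 2 ^ L)%N -> binset L k `<=` I01.
Proof.
move=> kL x xk; rewrite /I01/= in_itv/=; apply/andP; split.
  by apply: le_trans (inbin_lb xk); rewrite mulr_ge0 ?ler0n// invr_ge0 exprn_ge0.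
apply: le_trans (inbin_ub xk) _; rewrite ler_pdivrMr ?exprn_gt0// mul1r.
by rewrite -natrX ler_nat.
Qed.

Lemma measurable_inbin L k (D : set R) : measurable_fun D (fun x : R => (inbin L k x)%:R : R).
Proof.
have -> : (fun x : R => (inbin L k x)%:R : R) = \1_(binset L k).
  apply/funext => x; rewrite indicE; congr (_ %:R); congr nat_of_bool.
  by apply/idP/idP; rewrite inE.
by apply: measurable_indic; exact: measurable_binset.
Qed.

Definition binprob (L k : nat) : R :=
  fine (\int[mu]_(x in I01) (f0 x * (inbin L k x)%:R)%:E)%E.

Let mf0 : measurable_fun I01 f0. Proof. by case: df0. Qed.
Let f0_ge0 x : I01 x -> 0 <= f0 x.
Proof. by case: df0 => _ [H _] xI; apply: H; rewrite inE. Qed.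
Let f0_int : (\int[mu]_(x in I01) (f0 x)%:E = 1)%E. Proof. by case: df0 => _ []. Qed.

Lemma integral_binprob L k :
  (\int[mu]_(x in I01) (f0 x * (inbin L k x)%:R)%:E)%E = (binprob L k)%:E.
Proof.
rewrite /binprob fineK// ge0_fin_numE; last first.
  by apply: integral_ge0 => x xI; rewrite lee_fin mulr_ge0 ?f0_ge0.
apply: (@le_lt_trans _ _ 1%E); last exact: ltry.
rewrite -f0_int; apply: ge0_le_lower_integral => x xI; rewrite lee_fin.
  by rewrite mulr_ge0 ?f0_ge0.
by rewrite ler_piMr ?f0_ge0// lern1 leq_b1.
Qed.

Lemma integral_binprobC L k :
  (\int[mu]_(x in I01) (f0 x * (~~ inbin L k x)%:R)%:E)%E = (1 - binprob L k)%:E.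
Proof.
have notE x : (~~ inbin L k x)%:R = 1 - (inbin L k x)%:R :> R.
  by case: inbin; rewrite ?subrr ?subr0.
have mN : measurable_fun I01 (fun x : R => f0 x * (~~ inbin L k x)%:R).
  apply: measurable_funM => //; under eq_fun do rewrite notE.
  by apply: measurable_funB; [exact: measurable_cst|exact: measurable_inbin].
have mY : measurable_fun I01 (fun x : R => f0 x * (inbin L k x)%:R).
  by apply: measurable_funM => //; exact: measurable_inbin.
have := f0_int; under eq_integral => x _.
  rewrite (_ : (f0 x)%:E = ((f0 x * (inbin L k x)%:R)%:E + (f0 x * (~~ inbin L k x)%:R)%:E)%E);
    last by rewrite -EFinD -mulrDr notE addrC subrK mulr1.
  over.
rewrite ge0_integralD//; last 5 first.
- exact: measurable_I01.
- by move=> x xI; rewrite lee_fin mulr_ge0 ?f0_ge0.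
- exact: measurable_EFin.
- by move=> x xI; rewrite lee_fin mulr_ge0 ?f0_ge0.
- exact: measurable_EFin.
rewrite integral_binprob; set I := (\int[_]_(_ in _) _)%E.
case: I => [r||]//=; rewrite -EFinD => -[<-].
by rewrite addrAC subrr add0r.
Qed.

(** A bin has length [2 ^- L], so the middle term is the mean of [f0] over it. It serves both with
    the global bounds and with local Hölder bounds. *)
Lemma binprob_mean (lo hi : R) L k : (k < 2 ^ L)%N ->
  (forall x, inbin L k x -> lo <= f0 x <= hi) ->
  lo <= 2 ^+ L * binprob L k <= hi.
Proof.
move=> kL H; have K0 : 0 < 2 ^+ L :> R by rewrite exprn_gt0.
have E : ((binprob L k)%:E = \int[mu]_(x in binset L k) (f0 x)%:E)%E.
  rewrite -integral_binprob integral_mkcond [RHS]integral_mkcond; congr integral.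
  apply/funext => x; rewrite /patch.
  have [xk|xk] := boolP (x \in binset L k).
    rewrite mem_set; last by apply: (binset_sub kL); rewrite -inE.
    by move: xk; rewrite inE /binset/= => ->; rewrite mulr1.
  case: ifP => // _; move: xk; rewrite notin_setE /binset/= => /negP/negbTE ->.
  by rewrite mulr0.
have cE (c : R) : (\int[mu]_(x in binset L k) c%:E)%E = (c / 2 ^+ L)%:E.
  rewrite integral_cst; last exact: measurable_binset.
  by rewrite [X in (_ * X)%E](mu_binset L k) EFinM.
have f0b x : binset L k x -> 0 <= f0 x by move=> xk; apply: f0_ge0; exact: binset_sub xk.
apply/andP; split.
  (* Monotonicity of the lower integral asks for a nonnegative minorant, so a negative [lo] is
     treated apart. *)
  have [lo0|lo0] := leP 0 lo; last first.
    rewrite (le_trans (ltW lo0))// mulr_ge0 ?(ltW K0)//.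
    by rewrite -lee_fin E; apply: integral_ge0 => x xk; rewrite lee_fin f0b.
  rewrite mulrC -ler_pdivrMr// -lee_fin E -cE.
  by apply: ge0_le_lower_integral => x xk; rewrite lee_fin//; have /andP[] := H x xk.
rewrite mulrC -ler_pdivlMr// -lee_fin E -cE.
by apply: ge0_le_lower_integral => x xk; rewrite lee_fin ?f0b//; have /andP[] := H x xk.
Qed.

(** From [1 - l <= expR (- l)] comes [expR l <= 1 / (1 - l)], which is at most [1 + l + 2 * l ^+ 2]
    for [l <= 1 / 2]. *)
Lemma expR_le_quad (l : R) : l <= 1 / 2 -> expR l - 1 - l <= 2 * l ^+ 2.
Proof.
move=> l2; have := expR_ge1Dx (- l); rewrite expRN.
have l0 : 0 < 1 - l by lra.
have e0 := expR_gt0 l => h.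
have h1 : expR l * (1 - l) <= 1.
  by rewrite mulrC -ler_pdivlMr// mul1r.
suff : expR l <= 1 + l + 2 * l ^+ 2 by lra.
rewrite -(ler_pM2r l0); apply: le_trans h1 _.
have h2 : 0 <= l ^+ 2 * (1 - 2 * l) by rewrite mulr_ge0 ?sqr_ge0//; lra.
have -> : (1 + l + 2 * l ^+ 2) * (1 - l) = 1 + l ^+ 2 * (1 - 2 * l) by ring.
by lra.
Qed.

(** The exponential takes two values, so with [p] the bin probability the integral is
    [expR (- l p) * (1 + p * (expR l - 1))]; then [1 + x <= expR x] and [expR_le_quad] apply. Both
    signs of [l] are used later. *)
Lemma bernoulli_mgf (l : R) L k : l <= 1 / 2 -> 0 <= binprob L k ->
  exists2 t, (\int[mu]_(x in I01)
     (f0 x * expR (l * ((inbin L k x)%:R - binprob L k)))%:E = t%:E)%E &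
   0 <= t <= expR (2 * binprob L k * l ^+ 2).
Proof.
move=> l2 p0; set p := binprob L k in p0 *.
pose c (b : bool) := if b then expR (l * (1 - p)) else expR (- (l * p)).
pose phi (b : bool) (x : R) := f0 x * (if b then inbin L k x else ~~ inbin L k x)%:R.
pose t (b : bool) := if b then p else 1 - p.
have phi0 b x : I01 x -> 0 <= phi b x by move=> xI; rewrite mulr_ge0 ?f0_ge0.
have tE b : (\int[mu]_(x in I01) (phi b x)%:E)%E = (t b)%:E.
  by case: b; rewrite /phi /t; [exact: integral_binprob|exact: integral_binprobC].
have mphi b : measurable_fun I01 (phi b).
  apply: measurable_funM => //; case: b; first exact: measurable_inbin.
  rewrite (_ : (fun x => _) = (fun x : R => 1 - (inbin L k x)%:R)); last first.
    by apply/funext => x; case: inbin; rewrite ?subrr ?subr0.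
  by apply: measurable_funB; [exact: measurable_cst|exact: measurable_inbin].
have c0 b : 0 <= c b by case: b; exact: expR_ge0.
have IE := integral_lincomb measurable_I01 c0 mphi phi0 tE.
exists (\sum_b c b * t b).
  rewrite -IE; apply: eq_integral => x _; congr EFin.
  rewrite big_bool/= /phi /c; case: inbin => /=; rewrite ?mulr1 ?mulr0 ?addr0 ?add0r.
    by rewrite mulrC.
  by rewrite mulrN mulrC.
apply/andP; split.
  apply: sumr_ge0 => b _; rewrite mulr_ge0// -lee_fin -tE.
  by apply: integral_ge0 => x xI; rewrite lee_fin phi0.
rewrite big_bool/= /c /t.
have -> : expR (l * (1 - p)) * p + expR (- (l * p)) * (1 - p) =
    expR (- (l * p)) * (1 + p * (expR l - 1)).
  have -> : l * (1 - p) = l + - (l * p) by ring.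
  by rewrite expRD; ring.
apply: (@le_trans _ _ (expR (- (l * p)) * expR (p * (expR l - 1)))).
  by rewrite ler_wpM2l ?expR_ge0 ?expR_ge1Dx.
rewrite -expRD ler_expR.
have := ler_wpM2l p0 (expR_le_quad l2).
by lra.
Qed.

End counts.

(** * Expected posterior mass of the deviation event *)

Section expected_posterior.
Context {R : realType}.
Local Notation mu := (@lebesgue_measure R).

(** Pointwise in the sample, the posterior is at most a constant (good counts) plus a sum of
    Chernoff exponentials, one of which is at least 1 when some count is bad. This majorant is a
    finite sum of products, integrated exactly by [iint_sum_prod]. *)
Lemma expect_posterior_le L n (f0 : R -> R) (a : nat -> R) (c2 D e y rho : R)
    (B : set (R -> R)) (K : R := 2 ^+ L) (p := binprob f0 L) :
  density01 f0 -> (forall x, x \in I01 -> rho <= f0 x <= D) ->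
  y = n%:R / K -> (0 < n)%N -> 0 < D -> 0 < e -> 0 <= c2 <= e * y -> 2 <= e * y ->
  4 * e * (7 * D + 5) <= 1 -> (7 * D + 5) * e < rho ->
  ln n%:R <= e * (e * y) ->
  (forall k, (k < 2 ^ L)%N -> 0 <= a k <= c2) ->
  (forall w, hist L w \in B -> exists k : 'I_(2 ^ L),
     (p k + (7 * D + 5) * e / K < w k) \/ (w k < p k - (7 * D + 5) * e / K)) ->
  (0 <= expect_iid f0 n (fun X => hist_posterior L a n X B) <=
   (4 * K * (n%:R ^+ 2)^-1)%:E)%E.
Proof.
move=> df0 f0b yE n0 D0 e0 c2e ey2 eD erho lnx ac HB.
have K0 : 0 < K by rewrite exprn_gt0.
have n0' : 0 < n%:R :> R by rewrite ltr0n.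
have y0 : 0 < y by rewrite yE divr_gt0.
have nE : n%:R = K * y by rewrite yE mulrC divfK ?gt_eqF.
have ey0 : 0 < e * y by rewrite mulr_gt0.
have eD0 : 0 < e * D by rewrite mulr_gt0.
have e2 : e <= 1 / 2 by lra.
have pK k : (k < 2 ^ L)%N -> rho <= K * p k <= D.
  move=> kL; apply: binprob_mean => // x xk; apply: f0b; rewrite inE.
  exact: binset_sub xk.
have p0 k : (k < 2 ^ L)%N -> 0 <= p k.
  move=> /pK/andP[h _]; rewrite -(pmulr_rge0 _ K0); apply: le_trans h.
  by lra.
have f00 x : I01 x -> 0 <= f0 x.
  by case: df0 => _ [H _] xI; apply: H; rewrite inE.
(* The first boolean is a side; the second tells the constant terms ([true]) from the Chernoff terms
   ([false]). *)
pose J := (('I_(2 ^ L) * bool) * bool)%type.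
pose lam (s : bool) : R := if s then e else - e.
have lam2 s : lam s <= 1 / 2 by rewrite /lam; case: s; lra.
pose c (j : J) : R :=
  if j.2 then (n%:R ^+ 2)^-1 else expR (- (e * ((2 * D + 2) * (e * y)))).
pose phi (j : J) (x : R) : R :=
  if j.2 then f0 x else f0 x * expR (lam j.1.2 * ((inbin L j.1.1 x)%:R - p j.1.1)).
have c0 j : 0 <= c j.
  by rewrite /c; case: ifP => _; rewrite ?expR_ge0// invr_ge0 exprn_ge0.
have phi0 j x : I01 x -> 0 <= phi j x.
  by move=> xI; rewrite /phi; case: ifP => _; rewrite ?f00// mulr_ge0 ?f00 ?expR_ge0.
have mf0 : measurable_fun I01 f0 by case: df0.
have mphi j : measurable_fun I01 (phi j).
  rewrite /phi; case: (j.2) => //; apply: measurable_funM => //.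
  apply: (@measurableT_comp _ _ _ _ _ _ (@expR R)); first exact: measurable_expR.
  apply: measurable_funM; first exact: measurable_cst.
  by apply: measurable_funB; [exact: measurable_inbin|exact: measurable_cst].
have tex j : exists t, (\int[mu]_(x in I01) (phi j x)%:E = t%:E)%E /\
    c j * t ^+ n <= (n%:R ^+ 2)^-1.
  case: j => -[k s] [|].
    by exists 1; split; [case: df0 => _ []|rewrite /c/= expr1n mulr1].
  have [t tE /andP[t0 tle]] := bernoulli_mgf df0 (lam2 s) (p0 k (ltn_ord k)).
  exists t; split; first exact: tE.
  (* With [n = K * y] and [K * p k <= D], the exponent is at most [2 * D * e ^+ 2 * y - (2 * D + 2)
     * e ^+ 2 * y = - 2 * e ^+ 2 * y], hence at most [- 2 * ln n]. This fixes the constant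
     [2 * D + 2]. *)
  rewrite /c/=; apply: (@le_trans _ _ (expR (- (e * ((2 * D + 2) * (e * y)))) *
      expR (2 * p k * lam s ^+ 2) ^+ n)).
    by rewrite ler_wpM2l ?expR_ge0// lerXn2r ?nnegrE ?expR_ge0.
  rewrite -expRM_natl -expRD -[n%:R in leRHS]lnK ?posrE//.
  rewrite -expRM_natl -expRN ler_expR.
  have -> : lam s ^+ 2 = e ^+ 2 by rewrite /lam; case: (s); rewrite ?sqrrN.
  have /andP[_ pD] := pK k (ltn_ord k).
  have h : e * (e * y) * (K * p k) <= e * (e * y) * D.
    by rewrite ler_wpM2l// mulr_ge0 ?ltW.
  by rewrite {1}nE; lra.
have [t tP] := choice tex.
have tE j : (\int[mu]_(x in I01) (phi j x)%:E = (t j)%:E)%E by have [] := tP j.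
have tle j : c j * t j ^+ n <= (n%:R ^+ 2)^-1 by have [] := tP j.
have main : (0 <= expect_iid f0 n (fun X => hist_posterior L a n X B))%E /\
    (expect_iid f0 n (fun X => hist_posterior L a n X B) <=
     iint n (fun X => (\sum_(j : J) c j * \prod_(i < n) phi j (X i))%:E))%E.
  apply: le_iint => X XI; rewrite lee_fin.
    rewrite mulr_ge0//; last by have /andP[] := hist_posterior_le L a n X B.
    by apply: prodr_ge0 => i _; apply: f00; have := XI i (ltn_ord i); rewrite inE.
  have F0 : 0 <= \prod_(i < n) f0 (X i).
    by apply: prodr_ge0 => i _; apply: f00; have := XI i (ltn_ord i); rewrite inE.
  pose E (j : 'I_(2 ^ L) * bool) : R :=
    expR (lam j.2 * ((cnt L n X j.1)%:R - n%:R * p j.1) - e * ((2 * D + 2) * (e * y))).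
  (* The tilted products factor as the joint density times an exponential of the centred count. *)
  have -> : \sum_(j : J) c j * \prod_(i < n) phi j (X i) =
      (\prod_(i < n) f0 (X i)) * (\sum_(j : 'I_(2 ^ L) * bool) (n%:R ^+ 2)^-1 + \sum_j E j).
    rewrite -(pair_big xpredT xpredT (fun j s => c (j, s) * \prod_(i < n) phi (j, s) (X i)))/=.
    rewrite -big_split/= mulr_sumr; apply: eq_bigr => j _.
    rewrite big_bool/= mulrDr; congr (_ + _); first by rewrite mulrC.
    rewrite /c /phi/= big_split/= mulrCA; congr (_ * _).
    rewrite -expR_sum -expRD /E; congr expR.
    rewrite -mulr_sumr sumrB -natr_sum sumr_const card_ord -[p _ *+ n]mulr_natl.
    by rewrite addrC.
  rewrite ler_wpM2l//.
  have E0 : 0 <= \sum_j E j by apply: sumr_ge0 => j _; exact: expR_ge0.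
  have [/forallP good|] := boolP [forall k : 'I_(2 ^ L),
      `|(cnt L n X k)%:R - n%:R * p k| <= (2 * D + 2) * (e * y)].
    rewrite -[leLHS]addr0 lerD//.
    apply: (@hist_posterior_good _ L n X a p c2 D e y rho) => // k kL.
    exact: (good (Ordinal kL)).
  move=> /forallPn[k]; rewrite -ltNge => bad.
  apply: le_trans (hist_posterior_le1 _ _ _ _ _) _.
  have S0 : 0 <= \sum_(j : 'I_(2 ^ L) * bool) (n%:R ^+ 2)^-1 :> R.
    by apply: sumr_ge0 => j _; rewrite invr_ge0 exprn_ge0.
  (* Tilting in the direction of the deviation makes the exponent nonnegative. *)
  suff [s Es] : exists s, 1 <= E (k, s).
    apply: le_trans Es _; apply: (@le_trans _ _ (\sum_j E j)); last by rewrite lerDr.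
    by rewrite (bigD1 (k, s))//= lerDl sumr_ge0// => j _; exact: expR_ge0.
  have [h|h] := leP 0 ((cnt L n X k)%:R - n%:R * p k).
    exists true; rewrite /E/= -[leLHS]expR0 ler_expR -mulrBr mulr_ge0 ?(ltW e0)// subr_ge0.
    by move: bad; rewrite ger0_norm// => /ltW.
  exists false; rewrite /E/= -[leLHS]expR0 ler_expR mulNr -mulrN -mulrBr.
  rewrite mulr_ge0 ?(ltW e0)// subr_ge0.
  by move: bad; rewrite ltr0_norm// => /ltW.
have [-> le1] := main; rewrite /=; apply: le_trans le1 _.
rewrite (iint_sum_prod n c0 mphi phi0 tE) lee_fin.
apply: (@le_trans _ _ (\sum_(j : J) (n%:R ^+ 2)^-1)); first exact: ler_sum.
(* There are [4 * K] terms: two sides and two kinds for each bin. *)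
rewrite sumr_const !card_prod card_bool card_ord -[leLHS]mulr_natl.
rewrite -mulnA natrM natrX -/K mulrC [in leRHS]mulrC ler_pM2l ?invr_gt0 ?exprn_gt0//.
by rewrite mulrC.
Qed.

End expected_posterior.

(** * Asymptotics of the resolution and of the rate *)

Section rates.
Context {R : realType}.
Implicit Types alpha : R.

(** With [u = n / ln n] and [be = 1 / (2 * alpha + 1)], the floor in [Ln] gives
    [u ^ be / 2 <= K <= u ^ be], while [e = u ^ (- alpha * be)]; the bounds then compare powers of
    [u >= 1]. *)
Lemma Ln_epsn_bounds alpha n (K := 2 ^+ Ln alpha n) (e := epsn alpha n) :
  0 < alpha -> alpha <= 1 -> 1 <= ln n%:R :> R ->
  [/\ 0 < e, K <= n%:R, ln n%:R <= e * (e * (n%:R / K)) & K^-1 `^ alpha <= 2 * e].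
Proof.
move=> a0 a1 ln1.
have n0 : 0 < n%:R :> R.
  rewrite lt_def ler0n andbT; apply/eqP => n0; move: ln1.
  by rewrite n0 ln0// ler10.
have ln0 : 0 < ln n%:R :> R by lra.
set u := n%:R / ln n%:R : R.
have u0 : 0 < u by rewrite divr_gt0.
have u1 : 1 <= u by rewrite ler_pdivlMr// mul1r ltW// ln_sublinear.
set be := 1 / (2 * alpha + 1).
have d0 : 0 < 2 * alpha + 1 by lra.
have be0 : 0 < be by rewrite divr_gt0.
have be1 : be <= 1 by rewrite ler_pdivrMr// mul1r; lra.
have ub0 : 0 < u `^ be by rewrite powR_gt0.
have K0 : 0 < K by rewrite exprn_gt0.
have l2 : 0 < ln 2 :> R by rewrite ln_gt0// ltr1n.
have hE : (hn alpha n)^-1 = u `^ be by rewrite /hn -/u -/be powRN invrK.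
have /andP[L1 L2] : (Ln alpha n)%:R <= ln (u `^ be) / ln 2 < (Ln alpha n).+1%:R.
  rewrite /Ln hE; apply: truncn_itv; rewrite divr_ge0 ?(ltW l2)//.
  by rewrite ln_powR mulr_ge0 ?(ltW be0)// ln_ge0.
have expE m : 2 ^+ m = expR (m%:R * ln 2) :> R.
  by rewrite expRM_natl lnK// posrE.
have uE : u `^ be = expR (ln (u `^ be)) by rewrite lnK// posrE.
have Kle : K <= u `^ be.
  by rewrite uE /K expE ler_expR -ler_pdivlMr.
have Kge : u `^ be <= 2 * K.
  by rewrite uE /K -exprS expE ler_expR -ler_pdivrMr// ltW.
have eE : e = u `^ (- (alpha * be)).
  rewrite /e /epsn -[ln _ / _]invf_div -/u -(powR_inv1 (ltW u0)) -powRrM.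
  by congr powR; rewrite /be; field; rewrite gt_eqF.
have e0 : 0 < e by rewrite eE powR_gt0.
split=> //.
- apply: le_trans Kle _; apply: le_trans (ler1_powR u1 be1) _.
  by rewrite ler_pdivrMr// ler_peMr.
(* The exponents of [u] add up to -1, an exact balance; [K <= u ^ be] then turns it into the
   inequality. *)
- have -> : ln n%:R = e * e * (n%:R / u `^ be).
    rewrite eE -powRD ?(gt_eqF u0) ?implybT// mulrCA -powRN -powRD ?(gt_eqF u0) ?implybT//.
    have -> : - (alpha * be) + - (alpha * be) + - be = -1.
      by rewrite /be; field; rewrite gt_eqF.
    by rewrite powR_inv1 ?(ltW u0)// /u invf_div mulrC divfK ?gt_eqF.
  rewrite -mulrA ler_pM2l// ler_pM2l// ler_pM2l// lef_pV2 ?posrE//.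
(* The factor 2 from the floor becomes [2 ^ alpha], at most 2 because [alpha <= 1]. *)
- have K2 : K^-1 <= 2 * u `^ (- be).
    by rewrite powRN ler_pdivlMr// mulrC ler_pdivrMr.
  apply: (@le_trans _ _ ((2 * u `^ (- be)) `^ alpha)).
    by rewrite ge0_ler_powR ?nnegrE ?(ltW a0) ?invr_ge0 ?(ltW K0)// mulr_ge0 ?powR_ge0.
  rewrite powRM ?powR_ge0// -powRrM eE mulNr [be * _]mulrC.
  by rewrite ler_wpM2r ?powR_ge0// ler1_powR// ler1n.
Qed.

Lemma near_ln_ge1 : \forall n \near \oo, 1 <= ln n%:R :> R.
Proof.
near=> n; have : expR 1 <= n%:R :> R by near: n; exact: nbhs_infty_ger.
move=> en; rewrite -[leLHS]expRK ler_ln ?posrE ?expR_gt0//.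
exact: lt_le_trans (expR_gt0 _) en.
Unshelve. all: by end_near. Qed.

(** By [ln n <= 2 * sqrt n], the base [ln n / n] is at most [2 / sqrt n], hence at most
    [b = d ^ (1 / g)] as soon as [n >= (2 / b) ^ 2]. *)
Lemma near_epsn_le alpha (d : R) : 0 < alpha -> 0 < d ->
  \forall n \near \oo, epsn alpha n <= d.
Proof.
move=> a0 d0; near=> n.
set g := alpha / (2 * alpha + 1).
have g0 : 0 < g by rewrite divr_gt0//; lra.
set b := d `^ g^-1; have b0 : 0 < b by rewrite powR_gt0.
have n1 : 1 <= ln n%:R :> R by near: n; exact: near_ln_ge1.
have nb : (2 / b) ^+ 2 <= n%:R by near: n; exact: nbhs_infty_ger.
have n0 : 0 < n%:R :> R by apply: lt_le_trans nb; rewrite exprn_gt0// divr_gt0.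
have s0 : 0 < Num.sqrt n%:R :> R by rewrite sqrtr_gt0.
have sb : 2 / b <= Num.sqrt n%:R.
  rewrite (_ : 2 / b = Num.sqrt ((2 / b) ^+ 2)); last first.
    by rewrite sqrtr_sqr ger0_norm// divr_ge0// ltW.
  by rewrite ler_sqrt// ltW.
have -> : d = b `^ g by rewrite -powRrM mulVf ?gt_eqF// powRr1// ltW.
rewrite /epsn -/g ge0_ler_powR ?nnegrE ?(ltW g0) ?(ltW b0)//.
  by rewrite divr_ge0// (le_trans _ n1).
have lns : ln n%:R <= 2 * Num.sqrt n%:R :> R.
  rewrite -[n%:R in leLHS]sqr_sqrtr ?ler0n// lnXn// -[leLHS]mulr_natl ler_pM2l//.
  by rewrite ltW// ln_sublinear.
rewrite ler_pdivrMr//; apply: le_trans lns _.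
rewrite -[n%:R in leRHS]sqr_sqrtr ?ler0n// expr2 mulrA ler_pM2r//.
by rewrite mulrC -ler_pdivrMr.
Unshelve. all: by end_near. Qed.

End rates.


(* A sup-norm deviation is attained on one bin, where [f0] is close to the
   rescaled bin probability. *)
Lemma supnorm_deviation (R : realType) (alpha C t d : R) (f0 : R -> R) L
    (w : nat -> R) (K : R := 2 ^+ L) :
  density01 f0 -> 0 < alpha ->
  (forall x y : R, x \in I01 -> y \in I01 ->
     `|f0 x - f0 y| <= C * `|x - y| `^ alpha) ->
  0 <= C -> C * K^-1 `^ alpha <= d ->
  ((t + d)%:E < supnorm01 (fun x => (hist L w x - f0 x)%R))%E ->
  exists k : 'I_(2 ^ L), (binprob f0 L k + t / K < w k) \/
                         (w k < binprob f0 L k - t / K).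
Proof.
move=> df0 a0 hC C0 Cd /ereal_sup_gt[_ [x xI <-]]; rewrite lte_fin => dev.
have xI' : x \in I01 by rewrite inE.
have [k xk] := inbin_ex L xI'; exists k.
have K0 : 0 < K by rewrite exprn_gt0.
(* Two points of a bin are at most [1 / K] apart, so the Hölder bound keeps [f0] within [d] of
   [f0 x] throughout it. *)
have /andP[lo hi] : f0 x - d <= K * binprob f0 L k <= f0 x + d.
  apply: binprob_mean => // z zk.
  have zI : z \in I01 by rewrite inE; exact: binset_sub (ltn_ord k) _ zk.
  rewrite -ler_distl distrC; apply: le_trans (hC _ _ xI' zI) _.
  apply: le_trans Cd; rewrite ler_wpM2l// ge0_ler_powR ?nnegrE ?(ltW a0) ?normr_ge0//.
    by rewrite invr_ge0 ltW.
  have := inbin_lb xk; have := inbin_ub xk; have := inbin_lb zk; have := inbin_ub zk.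
  rewrite -[k.+1%:R]natr1 mulrDl mul1r -/K ler_norml => h1 h2 h3 h4.
  by apply/andP; split; lra.
move: dev; rewrite (hist_inbin _ xk) -/K => dev.
have dK (c : R) : K * (c / K) = c by rewrite mulrC divfK// gt_eqF.
have [h|h] := leP 0 (K * w k - f0 x).
  left; rewrite -(ltr_pM2l K0) mulrDr dK.
  by move: dev; rewrite ger0_norm//; lra.
right; rewrite -(ltr_pM2l K0) mulrBr dK.
by move: dev; rewrite ltr0_norm//; lra.
Qed.

(** * Convergence of the expected posterior mass to 0 *)

Lemma cvg_inv_natE (R : realType) (c : R) : (c / n%:R)%:E @[n --> \oo] --> 0%E.
Proof.
apply: cvg_EFin; first by near=> n.
rewrite (_ : 0 = c * 0); last by rewrite mulr0.
apply: cvgM; first exact: cvg_cst.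
apply/(gtr0_cvgV0 (f := fun n => n%:R)); last exact: cvgr_idn.
by near=> n; rewrite ltr0n; near: n; exists 1%N.
Unshelve. all: by end_near. Qed.

Theorem theorem3 (R : realType) (alpha rho0 D0 : R) (f0 : R -> R)
  (apar : nat -> nat -> R) (a c1 c2 : R) :
  1 / 2 < alpha -> alpha <= 1 ->
  density01 f0 ->
  0 < rho0 -> (forall x : R, x \in I01 -> rho0 <= f0 x /\ f0 x <= D0) ->
  holder alpha f0 ->
  0 < a -> 0 < c1 -> 0 < c2 ->
  (forall n k, (k < 2 ^ Ln alpha n)%N ->
     c1 * 2 `^ (- ((Ln alpha n)%:R * a)) <= apar n k /\ apar n k <= c2) ->
  forall M : nat -> R, M @ \oo --> +oo ->
  (fun n => expect_iid f0 n (fun X =>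
     hist_posterior (Ln alpha n) (apar n) n X
       [set f : R -> R | (supnorm01 (fun x => (f x - f0 x)%R) >
                 (M n * epsn alpha n)%:E)%E]))
    @ \oo --> 0%E.
Proof.
move=> ha a1 df0 rho_gt0 f0b [C hC] _ c1_gt0 c2_gt0 hapar M Moo.
have a0 : 0 < alpha by lra.
have D_gt0 : 0 < D0.
  have zI : (0 : R) \in I01 by rewrite inE /I01/= in_itv/= lexx ler01.
  by have [] := f0b _ zI; lra.
(* The Hölder constant comes without a sign, so its absolute value is used. *)
have hC' x y : x \in I01 -> y \in I01 -> `|f0 x - f0 y| <= `|C| * `|x - y| `^ alpha.
  move=> xI yI; apply: le_trans (hC x y xI yI) _.
  by rewrite ler_wpM2r ?powR_ge0// ler_norm.
set D5 := 7 * D0 + 5; have D5_gt0 : 0 < D5 by rewrite /D5; lra.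
(* The sequence is squeezed between 0 and [4 / n]. *)
apply: (squeeze_cvge _ (cvg_cst 0%E) (cvg_inv_natE 4)).
near=> n.
have n1 : 1 <= ln n%:R :> R by near: n; exact: near_ln_ge1.
have [e0 Kn lne Ke] := Ln_epsn_bounds a0 a1 n1.
have eD : epsn alpha n <= (4 * D5)^-1.
  by near: n; apply: near_epsn_le => //; rewrite invr_gt0 mulr_gt0.
have er : epsn alpha n <= rho0 / (2 * D5).
  by near: n; apply: near_epsn_le => //; rewrite divr_gt0 ?mulr_gt0.
have e2 : epsn alpha n <= 2^-1 by near: n; apply: near_epsn_le.
have ec : epsn alpha n <= c2^-1 by near: n; apply: near_epsn_le => //; rewrite invr_gt0.
(* [D5] covers the posterior spread and the other term the bias, bounded by [2 * |C| * e]. *)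
have Mn : D5 + 2 * `|C| <= M n by near: n; move/cvgryPge : Moo; exact.
move: e0 Kn lne Ke eD er e2 ec; set L := Ln alpha n; set e := epsn alpha n.
move=> e0 Kn lne Ke eD er e2 ec.
have K0 : 0 < 2 ^+ L :> R by rewrite exprn_gt0.
have n0 : (0 < n)%N by rewrite -(ltr0n R) (lt_le_trans K0).
have n0' : 0 < n%:R :> R by rewrite ltr0n.
(* As [e * (e * y) >= ln n >= 1], the upper bounds on [e] become the lower bounds 2 and [c2] on
   [e * y]. *)
have ey : e^-1 <= e * (n%:R / 2 ^+ L).
  by rewrite -div1r ler_pdivrMr// mulrC; exact: le_trans lne.
have ey2 : 2 <= e * (n%:R / 2 ^+ L).
  by apply: le_trans ey; rewrite -[leLHS]invrK lef_pV2// posrE.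
have ec2 : c2 <= e * (n%:R / 2 ^+ L).
  by apply: le_trans ey; rewrite -[leLHS]invrK lef_pV2// posrE invr_gt0.
have eD1 : 4 * e * D5 <= 1.
  by rewrite mulrAC -ler_pdivlMl ?mulr_gt0// mulr1.
have er1 : D5 * e < rho0.
  have : D5 * e <= rho0 / 2.
    by move: er; rewrite invfM mulrA ler_pdivlMr// mulrC.
  by move/le_lt_trans; apply; rewrite ltr_pdivrMr// ltr_pMr// ltr1n.
set B := [set f | _].
have HB w : hist L w \in B -> exists k : 'I_(2 ^ L),
    (binprob f0 L k + D5 * e / 2 ^+ L < w k) \/ (w k < binprob f0 L k - D5 * e / 2 ^+ L).
  rewrite inE /B/= => dev.
  apply: (@supnorm_deviation _ alpha `|C| (D5 * e) (2 * `|C| * e)) => //.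
    by rewrite [2 * _]mulrC -mulrA ler_wpM2l.
  by apply: le_lt_trans dev; rewrite lee_fin -mulrDl ler_pM2r.
have /andP[-> le1] : (0 <= expect_iid f0 n (fun X => hist_posterior L (apar n) n X B) <=
   (4 * 2 ^+ L * (n%:R ^+ 2)^-1)%:E)%E.
  apply: (@expect_posterior_le R L n f0 (apar n) c2 D0 e (n%:R / 2 ^+ L) rho0) => //.
  - by move=> x xI; have [-> ->] := f0b x xI.
  - by rewrite (ltW c2_gt0).
  - move=> k kL; have [lo ->] := hapar n k kL; rewrite andbT.
    by apply: le_trans lo; rewrite mulr_ge0 ?(ltW c1_gt0) ?powR_ge0.
(* Finally [K <= n] turns [4 * K / n ^ 2] into [4 / n]. *)
rewrite /=; apply: le_trans le1 _; rewrite lee_fin ler_pdivrMr ?exprn_gt0//.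
by rewrite expr2 mulrA divfK ?gt_eqF// ler_pM2l.
Unshelve. all: by end_near. Qed.
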